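(* Let $(g_n)$ be a sequence of ball-like subsets of the torus $\mathbb T^2$ with diameters $\rho_n$, let $(\xi_n)$ be a sequence of independent random variables uniformly distributed on $\mathbb T^2$, and let $$E=\limsup_{n\to\infty}(\xi_n+g_n)=\bigcap_{k=1}^\infty\bigcup_{n=k}^\infty(\xi_n+g_n)$$ be the associated random covering set. Let $$s_0=\limsup_{n\to\infty}\frac{\log n}{-\log\rho_n}$$ and suppose that $s_0<1$. Then, almost surely, for every line $\ell$ in the plane, $\dim_H\pi_\ell(E)=s_0$.
   Context: A sequence $(g_n)$ of subsets of $\mathbb T^2$ is called ball-like if, with $\rho_n$ denoting the diameter of $g_n$, the sequence $(\rho_n)$ decreases to zero and there are balls $B(x_n,\delta_n)\subset g_n$ such that $$\lim_{n\to\infty}\frac{\log\rho_n}{\log\delta_n}=1 .$$ (This is implied by $\limsup_{n\to\infty}\rho_n/\delta_n<+\infty$.) One also has $s_0=\inf\{s\ge0:\sum_{n=1}^\infty\rho_n^s<\infty\}$. The translates $\xi_n+g_n$ are taken in $\mathbb T^2$. For projections, $\mathbb T^2$ is embedded in $\mathbb R^2$ in the natural way, as the unit square, so that $E$ is regarded as a subset of the plane. $\pi_\ell$ denotes the orthogonal projection onto the line $\ell$, and $\dim_H$ is Hausdorff dimension. *)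

(* Defs.v *)
From HB Require Import structures.
From mathcomp Require Import all_boot all_order all_algebra finmap.
From mathcomp Require Import all_classical all_reals all_analysis.
From mathcomp Require Import ring.

Set Implicit Arguments.
Unset Strict Implicit.
Unset Printing Implicit Defensive.

Import Order.TTheory GRing.Theory Num.Theory.
Import numFieldNormedType.Exports.

Local Open Scope classical_set_scope.
Local Open Scope ring_scope.

(* Diameter and Hausdorff dimension, relative to a distance function d. *)
Section Hausdorff.
Context {R : realType} {X : Type} (d : X -> X -> R).

Definition diameter (A : set X) : \bar R :=
  ereal_sup [set (d x y)%:E | x in A & y in A].

(* diam(U)^s, with 0^0 = 1 for nonempty U; the empty set always counts 0. *)
Definition hausdorff_gauge (s : R) (U : set X) : \bar R :=
  if `[< U = set0 >] then 0%E else (diameter U `^ s)%E.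

Definition hausdorff_content (s delta : R) (A : set X) : \bar R :=
  ereal_inf [set (\sum_(0 <= i <oo) hausdorff_gauge s (U i))%E |
    U in [set U : (set X)^nat |
      A `<=` \bigcup_i U i /\ forall i, (diameter (U i) <= delta%:E)%E]].

Definition hausdorff_measure (s : R) (A : set X) : \bar R :=
  ereal_sup [set hausdorff_content s delta A | delta in [set delta | 0 < delta]].

Definition hausdorff_dim (A : set X) : \bar R :=
  ereal_inf [set s%:E | s in [set s : R | 0 <= s /\ hausdorff_measure s A = 0%E]].

End Hausdorff.

(* The norm of the library on R * R is the sup norm, hence the explicit
   Euclidean structure below. *)
Section Plane.
Context {R : realType}.

Definition dot (x y : R * R) : R := x.1 * y.1 + x.2 * y.2.

Definition euclid_dist (x y : R * R) : R := Num.sqrt (dot (x - y) (x - y)).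

Record line := Line {
  line_point : R * R;
  line_dir : R * R;
  line_dir_neq0 : line_dir != 0 }.

Definition line_set (l : line) : set (R * R) :=
  range (fun t : R => line_point l + t *: line_dir l).

Definition orth_proj (l : line) (x : R * R) : R * R :=
  line_point l +
  (dot (x - line_point l) (line_dir l) / dot (line_dir l) (line_dir l))
    *: line_dir l.

Lemma dot_dir_neq0 (l : line) : dot (line_dir l) (line_dir l) != 0.
Proof.
case: l => p [a b] /= ab0; rewrite /dot /= -!expr2.
apply: contra ab0; rewrite paddr_eq0 ?sqr_ge0// !sqrf_eq0.
by move=> /andP[/eqP -> /eqP ->].
Qed.

Lemma orth_proj_line (l : line) x : line_set l (orth_proj l x).
Proof. by eexists. Qed.

Lemma orth_proj_orth (l : line) x : dot (x - orth_proj l x) (line_dir l) = 0.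
Proof.
move: (dot_dir_neq0 l); rewrite /orth_proj; case: l => -[p q] [a b] /= _.
case: x => x y; rewrite /dot /= /GRing.scale /= => ab0.
by field.
Qed.

End Plane.
Arguments line : clear implicits.

(* The torus R^2/Z^2 is represented by the unit square [0, 1[^2, with addition
   modulo 1 in each coordinate; this is also its embedding in the plane. *)
Section Torus.
Context {R : realType}.

Definition torus : set (R * R) := `[0, 1[%classic `*` `[0, 1[%classic.

Definition frac (x : R) : R := x - (Num.floor x)%:~R.

Definition torus_add (x y : R * R) : R * R :=
  (frac (x.1 + y.1), frac (x.2 + y.2)).

Definition torus_translate (x : R * R) (A : set (R * R)) : set (R * R) :=
  torus_add x @` A.

(* For x, y in [0, 1[ this is the distance of x - y to the integers. *)
Definition circle_dist (x y : R) : R := Num.min `|x - y| (1 - `|x - y|).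

Definition torus_dist (x y : R * R) : R :=
  Num.sqrt (circle_dist x.1 y.1 ^+ 2 + circle_dist x.2 y.2 ^+ 2).

Definition torus_ball (x : R * R) (r : R) : set (R * R) :=
  [set y | torus y /\ torus_dist x y < r].

(* The diameter of a nonempty subset of the torus is finite. *)
Definition torus_diam (A : set (R * R)) : R := fine (diameter torus_dist A).

(* All sequences are indexed from 0: the term of index n is the (n+1)-st. *)
Definition ball_like (g : nat -> set (R * R)) : Prop :=
  [/\ forall n, g n `<=` torus,
      nonincreasing_seq (fun n => torus_diam (g n)),
      (fun n => torus_diam (g n)) @ \oo --> (0 : R) &
      exists (x : nat -> R * R) (delta : nat -> R),
        (forall n, [/\ torus (x n), 0 < delta n &
                       torus_ball (x n) (delta n) `<=` g n]) /\
        (fun n => ln (torus_diam (g n)) / ln (delta n)) @ \oo --> (1 : R)].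

Definition s0 (g : nat -> set (R * R)) : \bar R :=
  limn_esup (fun n => (ln n.+1%:R / - ln (torus_diam (g n)))%:E).

End Torus.

Section Random.
Context {d : measure_display} {T : measurableType d} {R : realType}
  (P : probability T R).

Definition uniform_torus (X : {RV P >-> (R * R)%type}) : Prop :=
  (forall w, torus (X w)) /\
  forall A : set (R * R), measurable A ->
    distribution P X A =
    (lebesgue_measure \x lebesgue_measure)%E (A `&` torus).

Definition independent_RVs (d' : measure_display) (T' : measurableType d')
    (X : nat -> {RV P >-> T'}) : Prop :=
  forall (J : {fset nat}) (A : nat -> set T'),
    (forall n, measurable (A n)) ->
    P (\bigcap_(n in [set` J]) (X n @^-1` A n)) =
    (\prod_(n <- J) P (X n @^-1` A n))%E.

Definition random_covering_set (xi : nat -> {RV P >-> (R * R)%type})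
    (g : nat -> set (R * R)) (w : T) : set (R * R) :=
  lim_sup_set (fun n => torus_translate (xi n w) (g n)).

End Random.

(* Main.v *)
Require Import Defs.
From mathcomp Require Import all_boot all_order all_algebra finmap.
From mathcomp Require Import all_classical all_reals all_analysis.
From mathcomp Require Import measurable_realfun.
From mathcomp Require Import ring lra zify.

Set Implicit Arguments.
Unset Strict Implicit.
Unset Printing Implicit Defensive.

Import Order.TTheory GRing.Theory Num.Theory.
Import numFieldNormedType.Exports.

Local Open Scope classical_set_scope.
Local Open Scope ring_scope.

(** Write [sigma] for [s0 g] and [rho n] for the diameter of [g n].

The upper bound holds for every sample. For [t > sigma] the series of the
[rho n ^ t] converges; a translate of [g n] may wrap around the torus, but its
part in each quarter of the unit square has Euclidean diameter at most [rho n],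
and projections do not increase distances, so the tails of the sequence of
translates give covers of the projection of arbitrarily small total gauge
([projection_null]).

The lower bound has to hold off a single null set for all lines at once. Lines
enter only through strips: the points whose projection falls in a set of
diameter [r] lie in a strip of width comparable to [r], and after rescaling
every strip is [|al * x + be * y - ga| <= t] with one coefficient equal to 1 and
the other in [[-1, 1]]. Up to rounding there are polynomially many strips of a
given width, so uniformity over all directions costs only a union bound.

At a scale [h], consider [h ^ (2 L + 1)] consecutive random balls. With
probability [1 - O(1 / h)] two things happen. Their centres visit every cell of
the grid of mesh [h ^ (- L)], since a cell expects about [h] of them
([spread_event]); and no strip of width [h ^ (- (2 L + 2))] contains more than
[4 L + 5] of them, since a strip expects about [1 / h] of them
([dispersed_event]). Hence, almost surely, after every index there are good
scales as large as desired ([ae_good_scale]). The definition of [s0] provides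
such scales at which the balls still have radius [h ^ (- a)], where
[a * t0 <= 2 L - 1] for a prescribed exponent [t0 < sigma] ([scales_radius]).

The rest is deterministic ([descent]). Given strips of widths [t i] with the sum
of the [t i ^ t0] small, a point that lies in infinitely many balls and outside
all strips is found as the common point of nested squares. A square of radius
[rho] is followed by squares around the centres chosen in the grid cells of its
middle part, for a scale [h] large in terms of [rho]. A strip of width [t] that
meets the square is charged [min(1, 22 (t / rho) ^ t0)], the potential-theoretic
analogue of a Frostman measure of the strip. Averaged over the children the
charge does not increase ([good_children]): strips wider than the grid mesh meet
a proportion [O(t / rho)] of the cells, hence [O((t / rho) ^ t0)] because
[t0 < 1], and thinner strips contain few centres at all. Some child therefore
has total charge at most that of its parent, and the charge stays below 1 along
a branch. As soon as the radius is below [t i], the charge of a strip that still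
meets the square would be 1; so the limit point avoids every strip. A cover of a
projection of [E] by sets of small total gauge would be such a family of strips
containing all of [E], which shows that the projection has positive measure for
every exponent below [sigma] ([projection_not_null]). *)

(* [frac] is also the underlying pair of a formal ratio of ring elements. *)
Local Notation frac := Defs.frac.

(** * Counting points in strips *)

Section Counting.
Context {R : realType}.
Implicit Types (al be ga t x y : R).

Definition lin al be (x : R * R) : R := al * x.1 + be * x.2.

(** The normalization makes every linear form 2-Lipschitz for the sup norm and
every non-degenerate direction representable, without square roots. *)
Definition slanted al be : Prop :=
  [/\ `|al| <= 1, `|be| <= 1 & al = 1 \/ be = 1].

Definition cell (H i j : nat) (x : R * R) : Prop :=
  (i%:R <= H%:R * x.1 < i.+1%:R) /\ (j%:R <= H%:R * x.2 < j.+1%:R).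

Lemma lin_le_sup al be r (x y : R * R) : slanted al be ->
  `|x.1 - y.1| <= r -> `|x.2 - y.2| <= r -> `|lin al be x - lin al be y| <= 2 * r.
Proof.
case=> ha hb _ h1 h2; rewrite /lin.
have -> : al * x.1 + be * x.2 - (al * y.1 + be * y.2) =
  al * (x.1 - y.1) + be * (x.2 - y.2) by ring.
rewrite (le_trans (ler_normD _ _))// !normrM.
rewrite (_ : 2 * r = 1 * r + 1 * r); last by ring.
by apply: lerD; apply: ler_pM.
Qed.

Lemma card_le_spread (u D : nat) (A : pred 'I_u) :
  (forall i j, A i -> A j -> (i <= j + D)%N) -> (#|A| <= D.+1)%N.
Proof.
move=> AD; have [/card0_eq A0|/card_gt0P[i0 i0A]] := posnP #|A|.
  by rewrite (eq_card0 A0).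
case: (arg_minnP (fun i : 'I_u => nat_of_ord i) i0A) => a aA amin.
pose f (i : 'I_u) : 'I_D.+1 := inord (i - a).
rewrite -[leqRHS]card_ord; apply: (leq_card_in f).
move=> i j iA jA /(congr1 val); rewrite /= !inordK ?ltnS; last 2 first.
- by rewrite leq_subLR AD.
- by rewrite leq_subLR AD.
move=> e; apply/val_inj => /=.
by have := amin i iA; have := amin j jA; lia.
Qed.

Lemma card_le_sum (T I : finType) (A : pred T) (B : I -> pred T) :
  (forall x : T, A x -> exists q, B q x) -> (#|A| <= \sum_q #|B q|)%N.
Proof.
move=> AB; rewrite -sum1_card.
under [leqRHS]eq_bigr do rewrite -sum1_card big_mkcond /=.
rewrite exchange_big big_mkcond /=; apply: leq_sum => x _.
by case: ifP => // /AB[q Bq]; rewrite (bigD1 q)//= [x \in _]Bq.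
Qed.

Lemma card_near (u : nat) x y : 0 <= y ->
  #|[pred i : 'I_u | `|i%:R - x| <= y]|%:R <= 2 * y + 1 :> R.
Proof.
move=> y0; apply: (@le_trans _ _ (Num.truncn (2 * y)).+1%:R).
  rewrite ler_nat; apply: card_le_spread => i j; rewrite !inE => hi hj.
  rewrite -ltnS -addnS -(ltr_nat R) natrD.
  have : 2 * y < (Num.truncn (2 * y)).+1%:R by rewrite truncnS_gt.
  move: hi hj; rewrite !ler_norml => /andP[? ?] /andP[? ?]; lra.
by rewrite -natr1 lerD2r truncn_le// mulr_ge0.
Qed.

Lemma card_pairs_le (u : nat) (Q : 'I_u -> 'I_u -> bool) (C : R) :
  (forall j, #|[pred i | Q i j]|%:R <= C) ->
  #|[pred p | Q p.1 p.2]|%:R <= u%:R * C.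
Proof.
move=> h; have -> : #|[pred p | Q p.1 p.2]| = (\sum_j #|[pred i | Q i j]|)%N.
  rewrite -sum1_card; transitivity (\sum_j \sum_(i | Q i j) 1)%N.
    rewrite (exchange_big_dep predT) //= pair_big_dep /=.
    by apply: eq_bigl => -[].
  by apply: eq_bigr => j _; rewrite sum1_card.
rewrite natr_sum (le_trans (ler_sum _ (fun j _ => h j)))//.
by rewrite sumr_const card_ord mulr_natl.
Qed.

Lemma card_pairs_swap (u : nat) (Q : 'I_u -> 'I_u -> bool) :
  #|[pred p | Q p.1 p.2]| = #|[pred p | Q p.2 p.1]|.
Proof.
rewrite -(@fintype.card_image _ _ (fun p : 'I_u * 'I_u => (p.2, p.1))); last first.
  by move=> [a b] [a' b'] /= [-> ->].
apply: eq_card => -[i j]; rewrite !inE /=; apply/fintype.imageP/idP.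
  by move=> [[a b]]; rewrite inE /= => ? [-> ->].
by move=> ?; exists (j, i).
Qed.

(** On each row of cells the form moves by [1 / H] from one cell to the next, so
a strip of half-width [3 t], enlarged by the cell size, meets at most
[10 t H + 1] cells of the row. *)
Lemma card_grid_strip_aux (u H i0 j0 : nat) (c : 'I_u -> 'I_u -> R * R) be ga t :
  (forall i j : 'I_u, cell H (i0 + i) (j0 + j) (c i j)) ->
  `|be| <= 1 -> 1 <= t * H%:R ->
  #|[pred p | `|(c p.1 p.2).1 + be * (c p.1 p.2).2 - ga| <= 3 * t]|%:R
     <= 11 * (t * H%:R) * u%:R :> R.
Proof.
move=> cH be1 tH.
rewrite [leRHS]mulrC.
apply: (@card_pairs_le u (fun i j => `|(c i j).1 + be * (c i j).2 - ga| <= 3 * t)) => j.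
set x := ga * H%:R - i0%:R - be * (j0 + j)%:R.
have H0 : 0 < H%:R :> R.
  by rewrite lt0r ler0n andbT; apply/eqP => h; move: tH; rewrite h; lra.
apply: (@le_trans _ _ (2 * (5 * (t * H%:R)) + 1)); last lra.
apply: le_trans (card_near u x _); last lra.
rewrite ler_nat; apply: subset_leq_card; apply/fintype.subsetP => i; rewrite !inE.
move: (cH i j); set p := c i j => -[].
rewrite natrD -natr1 natrD => /andP[h1 h2].
rewrite -natr1 => /andP[h3 h4] h.
have h' : `|H%:R * p.1 + be * (H%:R * p.2) - ga * H%:R| <= 3 * (t * H%:R).
  rewrite (_ : _ - _ = H%:R * (p.1 + be * p.2 - ga)); last by ring.
  by rewrite normrM (gtr0_norm H0) mulrC mulrA ler_pM2r.
have : `|be * (H%:R * p.2 - (j0 + j)%:R)| <= 1.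
  rewrite normrM -[leRHS]mulr1 ler_pM//.
  by rewrite ler_norml; apply/andP; split; lra.
rewrite /x; move: h'; rewrite !ler_norml => /andP[? ?] /andP[? ?].
by apply/andP; split; lra.
Qed.

Lemma card_grid_strip (u H i0 j0 : nat) (c : 'I_u * 'I_u -> R * R) al be ga t :
  (forall p : 'I_u * 'I_u, cell H (i0 + p.1) (j0 + p.2) (c p)) ->
  slanted al be -> 1 <= t * H%:R ->
  #|[pred p | `|lin al be (c p) - ga| <= 3 * t]|%:R
     <= 11 * (t * H%:R) * u%:R :> R.
Proof.
move=> cH [al1 be1 [alE|beE]] tH.
  have := @card_grid_strip_aux u H i0 j0 (fun i j => c (i, j)) be ga t
     (fun i j => cH (i, j)) be1 tH.
  move=> h; apply: le_trans h; rewrite ler_nat; apply/eq_leq/eq_card => -[i j].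
  by rewrite !inE /lin alE mul1r.
pose c' i j := ((c (j, i)).2, (c (j, i)).1).
have c'H (i j : 'I_u) : cell H (j0 + i) (i0 + j) (c' i j).
  by have [h1 h2] := cH (j, i); split.
have := card_grid_strip_aux ga c'H al1 tH.
rewrite (card_pairs_swap (fun i j : 'I_u => `|(c' i j).1 + al * (c' i j).2 - ga| <= 3 * t)).
move=> h; apply: le_trans h; rewrite ler_nat; apply/eq_leq/eq_card => -[i j].
by rewrite !inE /lin /= beE mul1r [al * _ + _]addrC.
Qed.

(** A strip of half-width [W] is a union of about [W K] strips of half-width
[1 / K]. *)
Lemma card_thick_strip (N K M : nat) (c : 'I_N -> R * R) al be ga W :
  (0 < K)%N -> 0 <= W ->
  (forall ga', (#|[pred n | (`|lin al be (c n) - ga'| <= K%:R^-1)%R]| <= M)%N) ->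
  #|[pred n | `|lin al be (c n) - ga| <= W]|%:R <= M%:R * (W * K%:R + 1) :> R.
Proof.
move=> K0 W0 hM.
have K0' : 0 < K%:R :> R by rewrite ltr0n.
pose Q := Num.truncn (W * K%:R).
pose gq (q : nat) := ga - W + (2 * q%:R + 1) / K%:R.
have Qlt : W * K%:R < Q.+1%:R by rewrite truncnS_gt.
apply: (@le_trans _ _ (M * Q.+1)%:R); last first.
  rewrite natrM ler_wpM2l// -natr1 lerD2r truncn_le//.
  by rewrite mulr_ge0.
rewrite ler_nat mulnC.
have /leq_trans : (#|[pred n | (`|lin al be (c n) - ga| <= W)%R]|
    <= \sum_(q < Q.+1) #|[pred n | (`|lin al be (c n) - gq q| <= K%:R^-1)%R]|)%N.
  apply: card_le_sum => n /=; rewrite ler_norml => /andP[h1 h2].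
  pose z := (lin al be (c n) - ga + W) * K%:R / 2.
  have z0 : 0 <= z by rewrite /z divr_ge0// mulr_ge0//; lra.
  have /andP[tl tu] := truncn_itv z0.
  have zQ : z <= W * K%:R.
    rewrite /z ler_pdivrMr// mulrAC ler_pM2r//; lra.
  have qQ : (Num.truncn z < Q.+1)%N.
    by rewrite -(ltr_nat R); apply: le_lt_trans Qlt; apply: le_trans zQ.
  exists (Ordinal qQ); rewrite /= /gq.
  have -> : lin al be (c n) - (ga - W + (2 * (Num.truncn z)%:R + 1) / K%:R)
     = (2 * z - (2 * (Num.truncn z)%:R + 1)) / K%:R.
    by rewrite /z; field; rewrite ?gt_eqF.
  rewrite normrM normfV (gtr0_norm K0') -[leRHS]mul1r ler_pM2r ?invr_gt0//.
  by rewrite ler_norml; move: tu; rewrite -natr1 => tu; apply/andP; split; lra.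
apply; apply: (@leq_trans (\sum_(q < Q.+1) M)%N).
  by apply: leq_sum => q _; exact: hM.
by rewrite sum_nat_const card_ord.
Qed.

End Counting.

(** * One generation of squares *)

Section Step.
Context {R : realType}.
Implicit Types (al be ga t : R) (L a M h m : nat) (c : nat -> R * R).

(** Constraints tying the integer exponents to [t0]: [3 <= L * (1 - t0)] makes
strips of width [h ^ (- L)] cheap, [a * t0 <= 2 L - 1] makes strips of width
[h ^ (- a)], the radius of the balls, cheap. *)
Definition admissible (t0 : R) L a : Prop :=
  [/\ 0 < t0, 3 <= L%:R * (1 - t0), a%:R * t0 <= L.*2%:R - 1 & (L <= a)%N].

(** Half of [h ^ (- a)], so that the square of this radius around a centre is
inside the Euclidean disc of radius [h ^ (- a)]. *)
Definition radius a h : R := (h%:R ^+ a)^-1 / 2.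

Definition spread c L m h : Prop :=
  forall i j, (i < h ^ L)%N -> (j < h ^ L)%N ->
    exists n : 'I_(h ^ L.*2.+1), cell (h ^ L) i j (c (m + n)%N).

Definition dispersed c L M m h : Prop :=
  forall al be ga, slanted al be ->
    (#|[pred n : 'I_(h ^ L.*2.+1) |
        (`|lin al be (c (m + n)%N) - ga| <= (h ^ L.*2.+2)%:R^-1)%R]| <= M)%N.

Lemma admissible_lt1 t0 L a : admissible t0 L a -> t0 < 1.
Proof.
case=> _ h _ _; rewrite ltNge; apply/negP => t1.
have : L%:R * (1 - t0) <= 0 by rewrite mulr_ge0_le0// subr_le0.
lra.
Qed.

(** For [t] between [h ^ (- a)] and [h ^ (- L)] the number of centres in a strip
of width [t] is bounded by the left-hand side. The term linear in [t] is
worst at [t = h ^ (- L)], where [3 <= L * (1 - t0)] leaves a factor [1 / h] to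
spare; the constant term is worst at [t = h ^ (- a)], where
[a * t0 <= 2 L - 1] does. The hypothesis on [24 * M] spends this factor. *)
Lemma thin_strip_estimate (t0 : R) L a M h (rho t u : R) :
  admissible t0 L a -> 0 < rho <= 1 -> (0 < h)%N ->
  24 * M%:R <= rho ^+ 2 * h%:R -> rho * h%:R ^+ L / 2 <= u ->
  radius a h <= t -> t <= rho -> t * h%:R ^+ L <= 1 ->
  M%:R * (3 * t * (h ^ L.*2.+2)%:R + 1) <= u ^+ 2 * (t / rho) `^ t0.
Proof.
move=> adm /andP[rho0 rho1] h0 hM hu rt trho tH.
have t1 := admissible_lt1 adm; case: adm => t00 hL ha _.
have h0' : 0 < h%:R :> R by rewrite ltr0n.
have h1 : 1 <= h%:R :> R by rewrite ler1n.
have H0 : 0 < h%:R ^+ L :> R by rewrite exprn_gt0.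
have t_gt0 : 0 < t.
  by apply: lt_le_trans rt; rewrite /radius divr_gt0// invr_gt0 exprn_gt0.
have T0 : 0 < t `^ t0 by rewrite powR_gt0.
have T1 : t `^ t0 <= (t / rho) `^ t0.
  apply: ge0_ler_powR; rewrite ?nnegrE ?divr_ge0 ?(ltW t00) ?(ltW t_gt0) ?(ltW rho0)//.
  by rewrite ler_pdivlMr// ler_piMr// ltW.
have u2 : rho ^+ 2 * (h%:R ^+ L) ^+ 2 / 4 <= u ^+ 2.
  rewrite (_ : _ / 4 = (rho * h%:R ^+ L / 2) ^+ 2); last by field.
  rewrite ler_pXn2r// nnegrE.
    by rewrite divr_ge0// mulr_ge0// ltW.
  by rewrite (le_trans _ hu)// divr_ge0// mulr_ge0// ltW.
apply: (@le_trans _ _ (rho ^+ 2 * (h%:R ^+ L) ^+ 2 / 4 * t `^ t0)); last first.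
  by apply: ler_pM => //; [rewrite divr_ge0// mulr_ge0// sqr_ge0|exact: ltW].
rewrite mulrDr mulr1 natrX.
have -> : h%:R ^+ L.*2.+2 = (h%:R ^+ L) ^+ 2 * h%:R ^+ 2 :> R.
  by rewrite -exprM muln2 -exprD addn2.
set H := h%:R ^+ L in H0 tH u2 *.
have E1 : t = t `^ t0 * t `^ (1 - t0).
  rewrite -powRD; last by apply/implyP => _; rewrite gt_eqF.
  by rewrite addrC subrK powRr1// ltW.
have E2 : t `^ (1 - t0) <= (h%:R ^+ 3)^-1.
  apply: (@le_trans _ _ (H^-1 `^ (1 - t0))).
    apply: ge0_ler_powR; rewrite ?nnegrE ?subr_ge0 ?invr_ge0 ?(ltW t_gt0) ?(ltW t1) ?(ltW H0)//.
    by rewrite -[H^-1]mul1r ler_pdivlMr.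
  rewrite -[H^-1]powR_invn ?(ltW h0')// -powRrM -powR_invn ?(ltW h0')//.
  by apply: ler_powR => //; rewrite mulNr lerN2.
have E3 : (h%:R ^+ a)^-1 `^ t0 / 2 <= t `^ t0.
  apply: (@le_trans _ _ (radius a h `^ t0)); last first.
    apply: ge0_ler_powR; rewrite ?nnegrE ?(ltW t00) ?(ltW t_gt0)//.
    by rewrite /radius divr_ge0// invr_ge0 exprn_ge0// ltW.
  rewrite /radius powRM ?invr_ge0 ?exprn_ge0 ?(ltW h0')//.
  rewrite ler_wpM2l ?powR_ge0//.
  by apply: ger1_powR; [apply/andP; split; lra|exact: ltW].
have E4 : h%:R <= H ^+ 2 * (h%:R ^+ a)^-1 `^ t0.
  rewrite /H -exprM muln2 -powR_invn ?(ltW h0')// -powRrM mulNr.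
  rewrite powRN ler_pdivlMr ?powR_gt0//.
  rewrite -[X in X * _]powRr1 ?(ltW h0')// -powRD; last by apply/implyP => _; rewrite gt_eqF.
  rewrite -powR_mulrn ?(ltW h0')//; apply: ler_powR => //; lra.
(* Half of the budget pays for each of the two terms of the count. *)
have P1 : M%:R * (3 * t * (H ^+ 2 * h%:R ^+ 2)) <= rho ^+ 2 * H ^+ 2 / 8 * t `^ t0.
  rewrite {1}E1.
  have -> : M%:R * (3 * (t `^ t0 * t `^ (1 - t0)) * (H ^+ 2 * h%:R ^+ 2)) =
     (24 * M%:R * (h%:R ^+ 2 * t `^ (1 - t0))) * (H ^+ 2 / 8 * t `^ t0) by field.
  have -> : rho ^+ 2 * H ^+ 2 / 8 * t `^ t0 = rho ^+ 2 * (H ^+ 2 / 8 * t `^ t0) by field.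
  apply: ler_wpM2r; first by rewrite mulr_ge0// ?divr_ge0// ?sqr_ge0// ltW.
  apply: (@le_trans _ _ (24 * M%:R * (h%:R ^+ 2 * (h%:R ^+ 3)^-1))).
    by rewrite !ler_wpM2l// ?mulr_ge0// exprn_ge0// ltW.
  rewrite (_ : h%:R ^+ 2 * _ = h%:R^-1); last by field; rewrite gt_eqF.
  by rewrite ler_pdivrMr.
have P2 : M%:R <= rho ^+ 2 * H ^+ 2 / 8 * t `^ t0.
  apply: (@le_trans _ _ (rho ^+ 2 * h%:R / 16)).
    have : 0 <= M%:R :> R by []. lra.
  apply: (@le_trans _ _ (rho ^+ 2 * (H ^+ 2 * (h%:R ^+ a)^-1 `^ t0) / 16)).
    by rewrite ler_wpM2r// ler_wpM2l// sqr_ge0.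
  have RH0 : 0 <= rho ^+ 2 * H ^+ 2 / 8 by rewrite divr_ge0// -exprMn sqr_ge0.
  have := ler_wpM2l RH0 E3.
  by apply: le_trans; lra.
lra.
Qed.

Definition sup_near (r : R) (x y : R * R) : Prop :=
  `|x.1 - y.1| <= r /\ `|x.2 - y.2| <= r.

(** The number of cells kept in a coordinate depends on the radius and the mesh
only, not on the position of the square, so the children of a square form a
square array. *)
Lemma grid_block (z rho : R) (H : nat) : 0 < rho -> rho <= z <= 1 - rho ->
  4 <= rho * H%:R ->
  exists i0 : nat, forall i, (i < (Num.truncn (rho * H%:R)).-1)%N ->
    (i0 + i < H)%N /\ forall x, (i0 + i)%:R <= H%:R * x < (i0 + i).+1%:R ->
      `|x - z| <= rho / 2.
Proof.
move=> rho0 /andP[zl zu] rH.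
have H0 : 0 < H%:R :> R.
  by rewrite lt0r ler0n andbT; apply/eqP => h; move: rH; rewrite h mulr0; lra.
pose y := (z - rho / 2) * H%:R.
have y0 : 0 <= y by rewrite /y mulr_ge0// ?ltW//; lra.
have /andP[ty yt] := truncn_itv y0.
have rH0 : 0 <= rho * H%:R by lra.
have /andP[tr rt] := truncn_itv rH0.
exists (Num.truncn y).+1 => i.
have t0 : (0 < Num.truncn (rho * H%:R))%N by rewrite truncn_gt0; lra.
rewrite -ltnS prednK// => iu.
have iu' : i%:R + 2 <= rho * H%:R.
  by apply: le_trans tr; rewrite -natrD ler_nat addn2.
have top : ((Num.truncn y).+1 + i).+1%:R <= (z + rho / 2) * H%:R.
  rewrite -natr1 natrD -natr1.
  have -> : (z + rho / 2) * H%:R = y + rho * H%:R by rewrite /y; field.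
  lra.
split.
  rewrite -(ltr_nat R).
  have : (z + rho / 2) * H%:R < H%:R by rewrite gtr_pMl//; lra.
  move: top; rewrite -natr1; lra.
move=> x /andP[x1 x2].
have b1 : y < H%:R * x by apply: lt_le_trans x1; apply: (lt_le_trans yt); rewrite ler_nat leq_addr.
have b2 : H%:R * x < (z + rho / 2) * H%:R by apply: lt_le_trans top.
rewrite ler_norml; apply/andP; split.
  by move: b1; rewrite /y mulrC ltr_pM2l//; lra.
by move: b2; rewrite mulrC ltr_pM2r//; lra.
Qed.

(** The charge of a strip for a square; it bounds from above the share of the
descendants of the square that the strip can meet. *)
Definition crossing (t0 : R) (z : R * R) rho al be ga t : R :=
  if `|lin al be z - ga| <= t + 2 * rho then
    Num.min 1 (22 * (t / rho) `^ t0)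
  else 0.

Lemma crossing_ge0 t0 z rho al be ga t : 0 <= crossing t0 z rho al be ga t.
Proof.
by rewrite /crossing; case: ifP => // _; rewrite le_min ler01 mulr_ge0// powR_ge0.
Qed.

Lemma crossing_le1 t0 z rho al be ga t : crossing t0 z rho al be ga t <= 1.
Proof. by rewrite /crossing; case: ifP => // _; rewrite ge_min lexx. Qed.

Lemma cell_inj (H i j i' j' : nat) (x : R * R) :
  cell H i j x -> cell H i' j' x -> i = i' /\ j = j'.
Proof.
move=> [h1 h2] [h3 h4]; split.
  by rewrite -(truncn_def h1) -(truncn_def h3).
by rewrite -(truncn_def h2) -(truncn_def h4).
Qed.

Lemma radius_gt0 a h : (0 < h)%N -> 0 < radius a h.
Proof. by move=> h0; rewrite /radius divr_gt0// invr_gt0 exprn_gt0// ltr0n. Qed.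

Lemma admissible_gt0 t0 L a : admissible t0 L a -> (0 < L)%N.
Proof.
by case=> _ hL _ _; rewrite lt0n; apply/eqP => L0; move: hL; rewrite L0 mul0r; lra.
Qed.

Lemma scale_large M h (rho : R) : 0 < rho <= 1 / 4 -> (0 < M)%N ->
  24 * M%:R <= rho ^+ 2 * h%:R -> (0 < h)%N /\ 96 <= rho * h%:R.
Proof.
move=> /andP[rho0 rho1] M0 hM.
have M1 : 1 <= M%:R :> R by rewrite ler1n.
have h0 : (0 < h)%N.
  by rewrite lt0n; apply/eqP => h0; move: hM; rewrite h0 mulr0; lra.
split => //.
have : rho ^+ 2 * h%:R <= 1 / 4 * (rho * h%:R).
  by rewrite expr2 -mulrA ler_wpM2r// mulr_ge0// ltW.
lra.
Qed.

Lemma radius_le_half L a h t0 (rho : R) : admissible t0 L a ->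
  0 < rho -> (0 < h)%N -> 96 <= rho * h%:R -> radius a h <= rho / 2.
Proof.
move=> adm rho0 h0 rh; have [_ _ _ La] := adm.
have a0 : (0 < a)%N by apply: leq_trans La; exact: admissible_gt0 adm.
have hh : rho * h%:R <= rho * h%:R ^+ a.
  by rewrite ler_wpM2l ?(ltW rho0)// -[leLHS]expr1 ler_weXn2l// ler1n.
by rewrite /radius ler_wpM2r// -[leLHS]mul1r ler_pdivrMr ?exprn_gt0 ?ltr0n//; lra.
Qed.

(** The children of a square are the chosen centres, one in each cell of the
central block; both regimes of strip widths give a fraction of crossed children
that is small against the power [t0] of the relative width. *)
Lemma children_exist t0 L a M m h c (z : R * R) (rho : R) :
  admissible t0 L a -> 0 < rho <= 1 / 4 ->
  rho <= z.1 <= 1 - rho -> rho <= z.2 <= 1 - rho ->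
  (0 < M)%N -> 24 * M%:R <= rho ^+ 2 * h%:R ->
  spread c L m h -> dispersed c L M m h ->
  exists (u : nat) (n : 'I_u * 'I_u -> 'I_(h ^ L.*2.+1)),
    let crossed al be ga t :=
      #|[pred p | `|lin al be (c (m + n p)%N) - ga| <= 3 * t]|%:R in
    [/\ (0 < u)%N,
        forall p, sup_near (rho / 2) (c (m + n p)%N) z,
        forall al be ga, slanted al be ->
          crossed al be ga (radius a h)
            <= (u * u)%:R * (radius a h / rho) `^ t0
      & forall al be ga t, slanted al be -> radius a h <= t <= rho ->
          crossed al be ga t <= (u * u)%:R * (22 * (t / rho) `^ t0)].
Proof.
move=> adm rho4 z1 z2 M0 hM sp di.
have t1 := admissible_lt1 adm; have [t00 _ _ La] := adm.
have [h0 rh96] := scale_large rho4 M0 hM; have /andP[rho0 rho1] := rho4.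
have h0' : 0 < h%:R :> R by rewrite ltr0n.
have h1 : 1 <= h%:R :> R by rewrite ler1n.
have hH : h%:R <= h%:R ^+ L :> R.
  by rewrite -[leLHS]expr1 ler_weXn2l// (admissible_gt0 adm).
have rH : 96 <= rho * h%:R ^+ L.
  by apply: le_trans rh96 _; rewrite ler_wpM2l// ltW.
have rH' : 4 <= rho * (h ^ L)%:R.
  by rewrite natrX; apply: le_trans rH; rewrite ler_nat.
have [i0 hi] := grid_block rho0 z1 rH'.
have [j0 hj] := grid_block rho0 z2 rH'.
set u := (Num.truncn (rho * (h ^ L)%:R)).-1 in hi hj.
have u1 : (u.+1 = Num.truncn (rho * (h ^ L)%:R))%N.
  by rewrite /u prednK// truncn_gt0 (le_trans _ rH')// ler1n.
have uge : rho * h%:R ^+ L / 2 <= u%:R.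
  have := truncnS_gt (rho * (h ^ L)%:R); rewrite -u1 natrX -addn2 natrD.
  by move: rH; clear; lra.
have u0 : (0 < u)%N.
  by rewrite -(ltr_nat R); apply: lt_le_trans uge; rewrite divr_gt0// (lt_le_trans _ rH).
have /choice[n hn] (p : 'I_u * 'I_u) : exists n : 'I_(h ^ L.*2.+1),
    cell (h ^ L) (i0 + p.1) (j0 + p.2) (c (m + n)%N).
  apply: sp; first by have [] := hi p.1 (ltn_ord _).
  by have [] := hj p.2 (ltn_ord _).
have ninj : injective n.
  move=> [i j] [i' j'] e; have := hn (i, j); rewrite e => /(cell_inj (hn (i', j')))/=.
  by move=> [/addnI/val_inj -> /addnI/val_inj ->].
exists u, n => crossed.
have r0 := @radius_gt0 a h h0.
have ha1 : h%:R ^+ L <= h%:R ^+ a :> R by rewrite ler_weXn2l.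
have rH1 : radius a h * h%:R ^+ L <= 1.
  rewrite /radius mulrAC ler_pdivrMr// mulrC ler_pdivrMr ?exprn_gt0//.
  have : 0 <= h%:R ^+ a :> R by rewrite exprn_ge0// ltW.
  by move: ha1; clear; lra.
have thin al be ga t : slanted al be -> radius a h <= t -> t <= rho ->
    t * h%:R ^+ L <= 1 -> crossed al be ga t <= (u * u)%:R * (t / rho) `^ t0.
  move=> sl rt trho tH; rewrite natrM -expr2.
  apply: le_trans (thin_strip_estimate adm _ h0 hM uge rt trho tH); last first.
    by rewrite rho0 (le_trans rho1)// ler_pdivrMr// mul1r ler1n.
  have K0 : (0 < h ^ L.*2.+2)%N by rewrite expn_gt0 h0.
  have W0 : 0 <= 3 * t by rewrite mulr_ge0// (le_trans _ rt)// ltW.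
  apply: le_trans (@card_thick_strip R _ _ M (fun q => c (m + q)%N) al be ga _
    K0 W0 (fun ga' => di al be ga' sl)).
  rewrite /crossed ler_nat -(fintype.card_image ninj).
  apply: subset_leq_card; apply/fintype.subsetP => q /fintype.imageP[p hp ->].
  exact: hp.
have rrho := radius_le_half adm rho0 h0 rh96.
have rrho' : radius a h <= rho by move: rrho rho0; clear; lra.
split => //.
- move=> p; have [h3 h4] := hn p; split.
    by have [_] := hi p.1 (ltn_ord _); apply.
  by have [_] := hj p.2 (ltn_ord _); apply.
- by move=> al be ga sl; exact: thin.
move=> al be ga t sl /andP[rt trho].
have t_gt0 : 0 < t by apply: lt_le_trans rt.
have tr0 : 0 < t / rho by rewrite divr_gt0.
have y0 : 0 <= (t / rho) `^ t0 by exact: powR_ge0.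
have [tH|tH] := leP (t * h%:R ^+ L) 1.
  apply: le_trans (thin al be ga t sl rt trho tH) _.
  by rewrite ler_wpM2l// ler_peMl// ler1n.
have tH' : 1 <= t * (h ^ L)%:R by rewrite natrX ltW.
apply: le_trans (card_grid_strip ga hn sl tH') _.
have h3 : t / rho <= (t / rho) `^ t0.
  by apply: ger1_powR; [rewrite tr0 ler_pdivrMr// mul1r|exact: ltW].
have h5 : 22 * u%:R * (t / rho) <= 22 * u%:R * (t / rho) `^ t0.
  by rewrite ler_wpM2l// mulr_ge0.
have h6 : t * h%:R ^+ L / 2 <= u%:R * (t / rho).
  have -> : t * h%:R ^+ L / 2 = (rho * h%:R ^+ L / 2) * (t / rho).
    by field; rewrite gt_eqF.
  by rewrite ler_wpM2r// ltW.
have h7 : 11 * (t * (h ^ L)%:R) <= u%:R * (22 * (t / rho) `^ t0).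
  by rewrite natrX; move: h5 h6; clear; lra.
by rewrite natrM -[leRHS]mulrA [leLHS]mulrC ler_wpM2l.
Qed.

(** A strip that meets a child meets the parent: the enlargement by [2 * rho] in
[crossing] absorbs the distance between the centres. *)
Lemma crossing_child al be ga t t0 (z z' : R * R) (rho rho' : R) :
  slanted al be -> sup_near (rho / 2) z' z -> rho' <= rho / 2 ->
  `|lin al be z' - ga| <= t + 2 * rho' -> `|lin al be z - ga| <= t + 2 * rho.
Proof.
move=> sl [n1 n2] rr; have := lin_le_sup sl n1 n2.
rewrite !ler_norml => /andP[? ?] /andP[? ?]; apply/andP; split; lra.
Qed.

(** The charge is a supermartingale along the tree. For [t] below the radius
[r] of the children, the proportion of crossed children is at most
[(r / rho) ^ t0], with constant 1, so that the constant 22 does not grow from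
one generation to the next. *)
Lemma good_children t0 L a M m h c (z : R * R) (rho : R) :
  admissible t0 L a -> 0 < rho <= 1 / 4 ->
  rho <= z.1 <= 1 - rho -> rho <= z.2 <= 1 - rho ->
  (0 < M)%N -> 24 * M%:R <= rho ^+ 2 * h%:R ->
  spread c L m h -> dispersed c L M m h ->
  exists (u : nat) (n : 'I_u * 'I_u -> 'I_(h ^ L.*2.+1)),
    [/\ (0 < u)%N,
        forall p, sup_near (rho / 2) (c (m + n p)%N) z
      & forall al be ga t, slanted al be -> 0 < t ->
        \sum_p crossing t0 (c (m + n p)%N) (radius a h) al be ga t
          <= (u * u)%:R * crossing t0 z rho al be ga t].
Proof.
move=> adm rho4 z1 z2 M0 hM sp di.
have [t00 _ _ _] := adm.
have [h0 rh96] := scale_large rho4 M0 hM; have /andP[rho0 _] := rho4.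
have [u [n [u0 nn thinnest wide]]] := children_exist adm rho4 z1 z2 M0 hM sp di.
have r0 := @radius_gt0 a h h0.
have rrho := radius_le_half adm rho0 h0 rh96.
exists u, n; split => // al be ga t sl t_gt0.
have [par|par] := boolP (`|lin al be z - ga| <= t + 2 * rho); last first.
  rewrite [X in _ <= _ * X]/crossing (negbTE par) mulr0 big1// => p _.
  rewrite /crossing ifF//; apply/negP => ch; move/negP: par; apply.
  exact: crossing_child sl (nn p) rrho ch.
have -> : crossing t0 z rho al be ga t = Num.min 1 (22 * (t / rho) `^ t0).
  by rewrite /crossing par.
have uu0 : 0 <= (u * u)%:R :> R by [].
have card_le (W v : R) :
    (forall p, crossing t0 (c (m + n p)%N) (radius a h) al be ga t <= v) ->
    0 <= v -> t + 2 * radius a h <= W ->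
    \sum_p crossing t0 (c (m + n p)%N) (radius a h) al be ga t <=
    #|[pred p | `|lin al be (c (m + n p)%N) - ga| <= W]|%:R * v.
  move=> hv v0 hW; rewrite mulr_natl -sumr_const [leRHS]big_mkcond/=.
  apply: ler_sum => p _; case: ifPn => // hp; rewrite /crossing ifF//.
  by apply/negP => h3; move/negP: hp; apply; exact: le_trans hW.
have [big|small] := leP 1 (22 * (t / rho) `^ t0).
  rewrite mulr1; apply: (@le_trans _ _ (\sum_(p : 'I_u * 'I_u) 1)).
    by apply: ler_sum => p _; exact: crossing_le1.
  by rewrite sumr_const card_prod card_ord.
have trho : t <= rho.
  rewrite leNgt; apply/negP => rhot; move: small; apply/negP; rewrite -leNgt.
  have t1 : 1 <= (t / rho) `^ t0.
    have {1}-> : 1 = 1 `^ t0 :> R by rewrite powR1.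
    apply: ge0_ler_powR; rewrite ?nnegrE ?(ltW t00) ?divr_ge0 ?(ltW t_gt0) ?(ltW rho0)//.
    by rewrite ler_pdivlMr// mul1r ltW.
  by rewrite (le_trans t1)// ler_peMl ?powR_ge0// ler1n.
have [rt|tr] := leP (radius a h) t.
  have W : t + 2 * radius a h <= 3 * t by move: rt; clear; lra.
  apply: le_trans (card_le _ 1 (fun p => crossing_le1 _ _ _ _ _ _ _) ler01 W) _.
  by rewrite mulr1; apply: wide => //; rewrite rt.
pose v := 22 * (t / radius a h) `^ t0.
have v0 : 0 <= v by rewrite mulr_ge0// powR_ge0.
have hv p : crossing t0 (c (m + n p)%N) (radius a h) al be ga t <= v.
  by rewrite /crossing; case: ifP => // _; rewrite ge_min lexx orbT.
have W : t + 2 * radius a h <= 3 * radius a h by move: tr; clear; lra.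
apply: le_trans (card_le _ _ hv v0 W) _.
have := thinnest al be ga sl.
move=> /(ler_wpM2r v0) /le_trans; apply.
rewrite /v -mulrA ler_wpM2l//.
rewrite mulrCA -powRM ?divr_ge0 ?(ltW r0) ?(ltW rho0) ?(ltW t_gt0)//.
rewrite (_ : radius a h / rho * (t / radius a h) = t / rho)//.
by field; rewrite !gt_eqF.
Qed.

End Step.

(** * Nested squares avoiding a family of strips *)

Section Descent.
Context {R : realType}.
Implicit Types (L a M h m : nat).

Lemma nested_intervals (lo hi : nat -> R) :
  (forall k, lo k <= lo k.+1) -> (forall k, hi k.+1 <= hi k) ->
  (forall k, lo k <= hi k) -> exists y, forall k, lo k <= y <= hi k.
Proof.
move=> hlo hhi lh.
have lom : nondecreasing_seq lo by exact/nondecreasing_seqP.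
have him : nonincreasing_seq hi by exact/nonincreasing_seqP.
have ub k : ubound (range lo) (hi k).
  move=> _ [j _ <-]; rewrite (le_trans (lom _ _ (leq_maxl j k)))//.
  by rewrite (le_trans (lh _))// him// leq_maxr.
exists (sup (range lo)) => k; apply/andP; split.
  by apply: ub_le_sup; [exists (hi 0%N); exact: ub|exists k].
by apply: ge_sup; [exists (lo 0%N), 0%N|exact: ub].
Qed.

Record good_scale (c : nat -> R * R) (delta : nat -> R) L a M m h : Prop := GoodScale {
  good_scale_radius : forall n, (m <= n < m + h ^ L.*2.+1)%N -> (h%:R ^+ a)^-1 <= delta n ;
  good_scale_spread : spread c L m h ;
  good_scale_dispersed : dispersed c L M m h }.

Variables (c : nat -> R * R) (delta : nat -> R) (t0 : R) (L a M n1 : nat).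
Hypothesis adm : admissible t0 L a.
Hypothesis M0 : (0 < M)%N.
Hypothesis good : forall m h0, (n1 <= m)%N ->
  exists2 h, (h0 <= h)%N & good_scale c delta L a M m h.

Variables al be ga t : nat -> R.
Hypothesis sl : forall i, slanted (al i) (be i).
Hypothesis t_gt0 : forall i, 0 < t i.

Definition cost (z : R * R) rho : \bar R :=
  (\sum_(0 <= i <oo) (crossing t0 z rho (al i) (be i) (ga i) (t i))%:E)%E.

Let crossing_ge0E z rho i :
  (0 <= (crossing t0 z rho (al i) (be i) (ga i) (t i))%:E)%E.
Proof. by rewrite lee_fin crossing_ge0. Qed.

Lemma cost_ge (z : R * R) rho i :
  ((crossing t0 z rho (al i) (be i) (ga i) (t i))%:E <= cost z rho)%E.
Proof.
rewrite /cost (@nneseriesD1 R (fun i => (crossing t0 z rho (al i) (be i) (ga i) (t i))%:E)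
  i xpredT)//= leeDl// nneseries_ge0// => *; exact: crossing_ge0E.
Qed.

(** A node consists of a square, given by its centre and radius, and of the first
index from which its descendants may be chosen. *)
Definition node : Type := (R * R) * R * nat.

Definition alive (s : node) : Prop :=
  let: (z, rho, m) := s in
  [/\ 0 < rho <= 1 / 4, rho <= z.1 <= 1 - rho, rho <= z.2 <= 1 - rho,
     (cost z rho < 1)%E & (n1 <= m)%N].

Definition child (s s' : node) : Prop :=
  let: (z, rho, m) := s in let: (z', rho', m') := s' in
  exists n, [/\ (m <= n < m')%N, z' = c n, rho' <= delta n / 2,
    sup_near (rho / 2) z' z & rho' <= rho / 2].

(** The sum over the children of their costs is at most the number of children
times the cost of the parent, so some child is not more expensive. *)
Lemma alive_child s : alive s -> exists2 s', alive s' & child s s'.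
Proof.
case: s => [[z rho] m] [rho4 z1 z2 cost1 n1m]; have /andP[rho0 rho1] := rho4.
(* The scale is chosen large in terms of the radius of the parent. *)
have [h h0 [hd hs hdi]] := good (Num.truncn (24 * M%:R / rho ^+ 2)).+1 n1m.
have hM : 24 * M%:R <= rho ^+ 2 * h%:R.
  rewrite -ler_pdivrMl ?exprn_gt0// [leLHS]mulrC ltW//.
  by rewrite (lt_le_trans (truncnS_gt _))// ler_nat.
have [u [n [u0 nn hn]]] := good_children adm rho4 z1 z2 M0 hM hs hdi.
have [hp rh] := scale_large rho4 M0 hM.
have r0 := @radius_gt0 R a h hp.
have rrho := radius_le_half adm rho0 hp rh.
have [p hp1] : exists p, (cost (c (m + n p)%N) (radius a h) <= cost z rho)%E.
  apply/not_existsP => H.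
  have lt p : (cost z rho < cost (c (m + n p)%N) (radius a h))%E.
    by rewrite ltNge; apply/negP/H.
  have cost_fin : cost z rho \is a fin_num.
    rewrite ge0_fin_numE; first exact: lt_trans cost1 (ltry _).
    by rewrite /cost nneseries_ge0// => *; exact: crossing_ge0E.
  have sum_le : (\sum_p cost (c (m + n p)%N) (radius a h) <= (u * u)%:R%:E * cost z rho)%E.
    rewrite /cost -nneseries_sum; last by move=> *; exact: crossing_ge0E.
    rewrite -nneseriesZl; last by move=> *; exact: crossing_ge0E.
    apply: lee_nneseries => [i _ _|i _].
      by apply: sume_ge0 => *; exact: crossing_ge0E.
    by rewrite sumEFin -EFinM lee_fin hn.
  have p0 : 'I_u * 'I_u by exact: (Ordinal u0, Ordinal u0).
  have : (\sum_(p : 'I_u * 'I_u) cost z rho < \sum_p cost (c (m + n p)%N) (radius a h))%E.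
    rewrite (bigD1 p0)//= [ltRHS](bigD1 p0)//=.
    apply: lte_leD; [|exact: lt|].
      by apply/sum_fin_numP => x _ _; exact: cost_fin.
    by apply: lee_sum => p _; exact: ltW.
  have -> : (\sum_(p : 'I_u * 'I_u) cost z rho = (u * u)%:R%:E * cost z rho)%E.
    rewrite -(fineK cost_fin) sumEFin -EFinM sumr_const card_prod card_ord.
    by rewrite mulr_natl.
  by rewrite ltNge sum_le.
have [n1' n2'] := nn p.
exists (c (m + n p)%N, radius a h, (m + n p)%N.+1).
  split.
  - by rewrite r0/=; move: rrho rho0 rho1; lra.
  - by move: n1' z1; rewrite ler_norml => /andP[? ?] /andP[? ?]; apply/andP; split; lra.
  - by move: n2' z2; rewrite ler_norml => /andP[? ?] /andP[? ?]; apply/andP; split; lra.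
  - exact: le_lt_trans cost1.
  - by rewrite (leq_trans n1m)// -addnS leq_addr.
exists (m + n p)%N; split => //.
- by rewrite leq_addr ltnSn.
- by rewrite /radius ler_wpM2r// hd// leq_addr ltn_add2l ltn_ord.
Qed.

Lemma descent : (\sum_(0 <= i <oo) (t i `^ t0)%:E < 100^-1%:E)%E ->
  exists y : R * R,
    [/\ sup_near (1 / 4) y (1 / 2, 1 / 2),
      forall i, t i < `|lin (al i) (be i) y - ga i|
    & forall m, exists2 n, (m <= n)%N & sup_near (delta n / 2) y (c n)].
Proof.
move=> ht.
have [t00 _ _ _] := adm; have t01 := admissible_lt1 adm.
pose root : node := ((1 / 2, 1 / 2), 1 / 4, n1).
have root_alive : alive root.
  split => //=; [by lra|by lra|by lra|].
  apply: (@le_lt_trans _ _ (\sum_(0 <= i <oo) (100%:E * (t i `^ t0)%:E))%E).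
    apply: lee_nneseries => [*|i _]; first exact: crossing_ge0E.
    rewrite -EFinM lee_fin /crossing; case: ifP => _; last first.
      by rewrite mulr_ge0// powR_ge0.
    rewrite ge_min; apply/orP; right.
    rewrite invf_div divr1 powRM ?(ltW (t_gt0 _))//.
    have : 4 `^ t0 <= 4 :> R by apply: ler1_powR => //; [rewrite ler1n|exact: ltW].
    move=> /(ler_wpM2l (powR_ge0 (t i) t0)).
    have := powR_ge0 (t i) t0; lra.
  rewrite nneseriesZl; last by move=> *; rewrite lee_fin powR_ge0.
  by rewrite -[ltRHS](_ : 100%:E * 100^-1%:E = 1)%E ?lte_pmul2l// -EFinM divff.
pose X := {s : node | alive s}.
have step (x : X) : {y : X | child (sval x) (sval y)}.
  by apply: cid; case: x => s /= /alive_child[s' a' cs]; exists (exist _ s' a').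
have [f [f0 fS]] := dependent_choice step (exist _ root root_alive).
pose z k := (sval (f k)).1.1; pose rho k := (sval (f k)).1.2.
pose idx k := (sval (f k)).2.
have fA k : [/\ 0 < rho k <= 1 / 4, (cost (z k) (rho k) < 1)%E & True].
  by rewrite /rho /z; case: (f k) => -[[? ?] ?] /= [].
have fC k : exists n, [/\ (idx k <= n < idx k.+1)%N, z k.+1 = c n,
    rho k.+1 <= delta n / 2, sup_near (rho k / 2) (z k.+1) (z k) & rho k.+1 <= rho k / 2].
  by move: (fS k); rewrite /idx /z /rho; case: (sval (f k)) => -[? ?] ?;
     case: (sval (f k.+1)) => -[? ?] ?.
have [y1 hy1] : exists y, forall k, (z k).1 - rho k <= y <= (z k).1 + rho k.
  apply: nested_intervals => k.
  - have [n [_ _ _ [+ _] ?]] := fC k; rewrite ler_norml => /andP[? ?]; lra.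
  - have [n [_ _ _ [+ _] ?]] := fC k; rewrite ler_norml => /andP[? ?]; lra.
  - by have [/andP[? _] _ _] := fA k; lra.
have [y2 hy2] : exists y, forall k, (z k).2 - rho k <= y <= (z k).2 + rho k.
  apply: nested_intervals => k.
  - have [n [_ _ _ [_ +] ?]] := fC k; rewrite ler_norml => /andP[? ?]; lra.
  - have [n [_ _ _ [_ +] ?]] := fC k; rewrite ler_norml => /andP[? ?]; lra.
  - by have [/andP[? _] _ _] := fA k; lra.
have yz k : sup_near (rho k) (y1, y2) (z k).
  split => /=; rewrite ler_norml.
    by have := hy1 k; lra.
  by have := hy2 k; lra.
exists (y1, y2); split.
- by have := yz 0%N; rewrite /rho /z f0.
- move=> i; rewrite ltNge; apply/negP => hi.
  have rho_small k : rho k <= 2 ^- k.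
    elim: k => [|k ih]; first by rewrite /rho f0/= expr0 invr1; lra.
    have [n [_ _ _ _ ?]] := fC k.
    rewrite exprS invfM; lra.
  have [k hk] : exists k, rho k <= t i.
    exists (Num.truncn (t i)^-1).+1; set k := (X in rho X).
    apply: le_trans (rho_small k) _.
    rewrite -[leRHS]invrK lef_pV2 ?posrE ?exprn_gt0 ?invr_gt0//.
    apply: (@le_trans _ _ k%:R); first by rewrite ltW// truncnS_gt.
    by rewrite -natrX ler_nat ltnW// ltn_expl.
  have [/andP[rho0 _] c1 _] := fA k.
  move: c1; apply/negP; rewrite -leNgt.
  apply: le_trans (cost_ge _ _ i); rewrite lee_fin /crossing ifT.
    rewrite le_min lexx/=.
    have : 1 <= (t i / rho k) `^ t0.
      have {1}-> : 1 = 1 `^ t0 :> R by rewrite powR1.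
      apply: ge0_ler_powR; rewrite ?nnegrE ?(ltW t00) ?divr_ge0 ?(ltW (t_gt0 _)) ?(ltW rho0)//.
      by rewrite ler_pdivlMr// mul1r.
    lra.
  have [n1' n2'] := yz k.
  have := lin_le_sup (sl i) n1' n2'; move: hi.
  by rewrite !ler_norml => /andP[? ?] /andP[? ?]; apply/andP; split; lra.
- move=> m.
  have idx_ge k : (k <= idx k)%N.
    by elim: k => // k ih; have [n [h1 _ _ _ _]] := fC k; lia.
  have [n [/andP[h1 _] zc rd _ _]] := fC m.
  exists n; first exact: leq_trans (idx_ge m) h1.
  rewrite -zc; have [n1' n2'] := yz m.+1; split; exact: le_trans rd.
Qed.

End Descent.

(** * Areas of cells and strips on the torus *)

Section TorusArea.
Context {R : realType}.

Definition area : set (R * R) -> \bar R :=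
  (lebesgue_measure \x lebesgue_measure)%E.

Lemma frac_id (x : R) : 0 <= x < 1 -> frac x = x.
Proof.
by move=> x01; rewrite /frac (@Num.Theory.floor_def _ _ 0) ?subr0.
Qed.

Lemma frac_sub1 (x : R) : 1 <= x < 2 -> frac x = x - 1.
Proof.
by move=> x12; rewrite /frac (@Num.Theory.floor_def _ _ 1).
Qed.

Lemma frac_itv (x : R) : 0 <= frac x < 1.
Proof.
have /andP[h1 h2] := floor_itv x; rewrite /frac.
by rewrite subr_ge0 h1/= ltrBlDr addrC -intrD1.
Qed.

Lemma torusP (x : R * R) : torus x <-> 0 <= x.1 < 1 /\ 0 <= x.2 < 1.
Proof. by rewrite /torus /=; split=> -[]; rewrite /= !in_itv. Qed.

(** A translate of an arc of length [1 / H] of the circle contains an interval of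
half that length that does not wrap around. *)
Lemma frac_cell_preimage (H i : nat) (a : R) : (i < H)%N -> 0 <= a < 1 ->
  exists lo : R, [/\ 0 <= lo, lo + (2 * H%:R)^-1 <= 1 &
    forall x, lo <= x < lo + (2 * H%:R)^-1 ->
      i%:R <= H%:R * frac (x + a) < i.+1%:R].
Proof.
move=> iH /andP[a0 a1].
have H0 : 0 < H%:R :> R by rewrite ltr0n (leq_ltn_trans _ iH).
set p := i%:R / H%:R : R; set e := (2 * H%:R)^-1.
have e0 : 0 < e by rewrite invr_gt0 mulr_gt0.
have He : H%:R * e = 1 / 2 by rewrite /e; field; rewrite gt_eqF.
have p0 : 0 <= p by rewrite divr_ge0// ltW.
have p1 : p + 2 * e <= 1.
  have -> : p + 2 * e = i.+1%:R / H%:R.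
    by rewrite /p /e -natr1; field; rewrite gt_eqF.
  by rewrite ler_pdivrMr// mul1r ler_nat.
have pE y : p <= y < p + 2 * e -> i%:R <= H%:R * y < i.+1%:R.
  have ip : i%:R = H%:R * p by rewrite /p; field; rewrite gt_eqF.
  have Se : i.+1%:R = H%:R * (p + 2 * e) by rewrite -natr1 ip mulrDr; lra.
  by move=> /andP[y1 y2]; rewrite Se ip ler_pM2l// ltr_pM2l// y1.
have in0 x : p <= x + a < p + 2 * e -> i%:R <= H%:R * frac (x + a) < i.+1%:R.
  by move=> h; rewrite frac_id; [exact: pE|lra].
have in1 x : p <= x + a - 1 < p + 2 * e -> i%:R <= H%:R * frac (x + a) < i.+1%:R.
  by move=> h; rewrite frac_sub1; [exact: pE|lra].
have [ap|pa] := leP a p.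
  by exists (p - a); split; [lra|lra|] => x h; apply: in0; lra.
have [am|ma] := leP a (p + e).
  by exists 0; split; [lra|lra|] => x h; apply: in0; lra.
have [aq|qa] := leP a (p + 2 * e).
  by exists (1 - e); split; [lra|lra|] => x h; apply: in1; lra.
by exists (p - a + 1); split; [lra|lra|] => x h; apply: in1; lra.
Qed.

Lemma area_box (x y e f : R) : 0 <= e -> 0 <= f ->
  area (`[x, x + e[%classic `*` `[y, y + f[%classic) = (e * f)%:E.
Proof.
move=> e0 f0; rewrite /area product_measure1E//= !lebesgue_measure_itv/= !lte_fin.
have len (u v : R) : 0 <= v ->
   (if u < u + v then ((u + v)%:E - u%:E)%E else 0%E) = v%:E.
  move=> v0; rewrite ltrDl; case: ifPn => [_|]; first by rewrite -EFinD addrAC subrr add0r.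
  by rewrite -leNgt => v0'; congr EFin; apply/le_anti; rewrite v0 v0'.
by rewrite !len.
Qed.

Definition strip (al be ga w : R) : set (R * R) :=
  [set x | `|lin al be x - ga| <= w].

Lemma measurable_strip al be ga w : measurable (strip al be ga w).
Proof.
pose f (x : R * R) := al * x.1 + be * x.2.
have mf : measurable_fun setT f.
  by apply: measurable_funD; apply: measurable_funM.
have -> : strip al be ga w = setT `&` f @^-1` `[ga - w, ga + w].
  rewrite setTI; apply/seteqP; split => x; rewrite /strip /f /lin /= in_itv/= ler_norml; lra.
by apply: mf.
Qed.

Lemma measurable_slab (al b ga w : R) :
  measurable [set x : R | `|al * x + b - ga| <= w].
Proof.
pose f (x : R) := al * x + b.
have mf : measurable_fun setT f.
  by apply: measurable_funD => //; apply: measurable_funM.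
have -> : [set x : R | `|al * x + b - ga| <= w] = setT `&` f @^-1` `[ga - w, ga + w].
  rewrite setTI; apply/seteqP; split => x; rewrite /f /= in_itv/= ler_norml; lra.
by apply: mf.
Qed.

Lemma lebesgue_slab (al b ga w : R) : 0 <= w -> 0 < al ->
  (lebesgue_measure [set x : R | (`|al * x + b - ga| <= w)%R] <= (2 * w / al)%:E)%E.
Proof.
move=> w0 al0.
have -> : [set x : R | (`|al * x + b - ga| <= w)%R] =
  `[(ga - b - w) / al, (ga - b + w) / al]%classic.
  apply/seteqP; split => x /=; rewrite in_itv/= ler_pdivlMr// ler_pdivrMr// ler_norml; lra.
rewrite lebesgue_measure_itv/=; case: ifP => _; last by rewrite lee_fin divr_ge0 ?mulr_ge0// ltW.
by rewrite -EFinD lee_fin; lra.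
Qed.

Let itv01 : lebesgue_measure (`[0 : R, 1[%classic : set R) = 1%E.
Proof. by rewrite lebesgue_measure_itv/= lte_fin ltr01 sube0. Qed.

Lemma integral_le_on01 (f : measurableTypeR R -> \bar R) (C : R) :
  measurable_fun setT f -> (forall x, (0 <= f x)%E) -> 0 <= C ->
  (forall x, (f x <= C%:E)%E) -> (forall x, ~ `[0, 1[%classic x -> f x = 0%E) ->
  (\int[lebesgue_measure]_x f x <= C%:E)%E.
Proof.
move=> mf f0 C0 fC fz.
have -> : f = f \_ (`[0%R, 1%R[%classic : set R).
  apply/funext => x; rewrite /patch; case: ifPn => //.
  by rewrite notin_setE => /fz.
rewrite -integral_mkcond.
have mf' := measurable_funS measurableT (@subsetT _ (`[0%R, 1%R[%classic : set R)) mf.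
apply: (@le_trans _ _ (\int[lebesgue_measure]_(x in (`[0%R, 1%R[%classic : set R)) (cst C%:E x))%E).
  by apply: ge0_le_integral => //= x _.
by rewrite integral_cst//= itv01 mule1.
Qed.

(** Fubini, integrating first in the coordinate whose coefficient is positive. *)
Lemma area_strip1 al be ga w : 0 <= w -> 0 < al ->
  (area (strip al be ga w `&` torus) <= (2 * w / al)%:E)%E.
Proof.
move=> w0 al0.
have mS : measurable (strip al be ga w `&` torus).
  by apply: measurableI; [exact: measurable_strip|exact: measurableX].
rewrite /area.
rewrite (product_measure_unique (m' := (lebesgue_measure \x^ lebesgue_measure)%E))//;
  last first.
  by move=> A B mA mB; exact: product_measure2E.
apply: integral_le_on01 => //=.
- exact: measurable_fun_ysection.
- by rewrite divr_ge0 ?mulr_ge0// ltW.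
- move=> y; apply: le_trans (lebesgue_slab (be * y) ga w0 al0).
  rewrite le_measure ?inE//; first exact: measurable_ysection.
    exact: measurable_slab.
  move=> x; rewrite /ysection/= inE => -[]; rewrite /strip /lin/=.
  done.
- move=> y hy; rewrite (_ : ysection _ _ = set0) ?measure0//.
  by apply/seteqP; split => // x; rewrite /ysection/= inE => -[] _ [].
Qed.

Lemma area_strip2 al be ga w : 0 <= w -> 0 < be ->
  (area (strip al be ga w `&` torus) <= (2 * w / be)%:E)%E.
Proof.
move=> w0 be0.
have mS : measurable (strip al be ga w `&` torus).
  by apply: measurableI; [exact: measurable_strip|exact: measurableX].
apply: integral_le_on01 => //=.
- exact: measurable_fun_xsection.
- by rewrite divr_ge0 ?mulr_ge0// ltW.
- move=> x; apply: le_trans (lebesgue_slab (al * x) ga w0 be0).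
  rewrite le_measure ?inE//; first exact: measurable_xsection.
    exact: measurable_slab.
  move=> y; rewrite /xsection/= inE => -[]; rewrite /strip /lin/=.
  by rewrite [be * y + _]addrC.
- move=> x hx; rewrite (_ : xsection _ _ = set0) ?measure0//.
  by apply/seteqP; split => // y; rewrite /xsection/= inE => -[] _ [].
Qed.

End TorusArea.

(** * A polynomial net of strips *)

Section Rounding.
Context {R : realType}.

(** The boolean tells which of the two coefficients of a strip of the net is [K];
the other one ranges over the integers between [- K] and [K]. *)
Definition net_coef (K : nat) (b : bool) (j : nat) : R :=
  if b then K%:R else j%:R - K%:R.

Lemma round_up (K N : nat) (s : R) : 0 < K%:R :> R -> `|s| <= N%:R ->
  exists j : 'I_(2 * N * K).+1,
    j%:R - N%:R * K%:R <= K%:R * s <= j%:R - N%:R * K%:R + 1.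
Proof.
move=> K0; rewrite ler_norml => /andP[s1 s2]; pose j := Num.truncn (K%:R * (s + N%:R)).
have j0 : 0 <= K%:R * (s + N%:R).
  by rewrite mulr_ge0 ?(ltW K0)//; move: s1; clear; lra.
have /andP[j1 j2] := truncn_itv j0; rewrite -/j -natr1 in j1 j2.
have jle : (j < (2 * N * K).+1)%N.
  rewrite ltnS -(ler_nat R); apply: le_trans j1 _.
  rewrite !natrM mulrC ler_pM2r//; move: s2; clear; lra.
by exists (Ordinal jle) => /=; move: j1 j2; clear; lra.
Qed.

(** Rounding the slope and the level of a strip of half-width [1 / K] to the
grid [1 / K] moves the linear form by at most [2 / K] on the unit square, so
the strip lies in a threefold wider one out of polynomially many. *)
Lemma strip_in_net (K : nat) (a b ga : R) : (0 < K)%N -> slanted a b -> `|ga| <= 3 ->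
  exists bb (j : 'I_(2 * 1 * K).+1) (q : 'I_(2 * 3 * K).+1), forall y : R * R, torus y ->
    `|lin a b y - ga| <= K%:R^-1 ->
    `|lin (net_coef K bb j) (net_coef K (~~ bb) j) y - (q%:R - 3 * K%:R)| <= 3.
Proof.
move=> K1 [a1 b1 ab] ga3; have K0 : 0 < K%:R :> R by rewrite ltr0n.
have [q hq] := @round_up K 3 ga K0 ga3.
have scaled y : `|lin a b y - ga| <= K%:R^-1 ->
    `|K%:R * lin a b y - K%:R * ga| <= 1.
  by move=> hy; rewrite -mulrBr normrM gtr0_norm// mulrC -ler_pdivlMr// mul1r.
have prod1 (u v : R) : 0 <= u < 1 -> 0 <= v <= 1 -> 0 <= u * v <= 1.
  move=> /andP[u0 u1] /andP[v0 v1]; rewrite mulr_ge0//=.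
  by rewrite -[leRHS]mulr1 ler_pM// ltW.
case: ab => e1.
  have [j hj] := @round_up K 1 b K0 b1.
  exists true, j, q => y /torusP[y1 y2] /scaled.
  have : 0 <= y.2 * (K%:R * b - (j%:R - K%:R)) <= 1.
    by apply: prod1 => //; move: hj; clear; lra.
  move: hq; clear -e1; rewrite e1 /lin /net_coef /= !ler_norml.
  by move=> /andP[? ?] /andP[? ?] /andP[? ?]; apply/andP; split; lra.
have [j hj] := @round_up K 1 a K0 a1.
exists false, j, q => y /torusP[y1 y2] /scaled.
have : 0 <= y.1 * (K%:R * a - (j%:R - K%:R)) <= 1.
  by apply: prod1 => //; move: hj; clear; lra.
move: hq; clear -e1; rewrite e1 /lin /net_coef /= !ler_norml.
by move=> /andP[? ?] /andP[? ?] /andP[? ?]; apply/andP; split; lra.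
Qed.

Lemma lin_torus_le2 (a b : R) (y : R * R) : slanted a b -> torus y -> `|lin a b y| <= 2.
Proof.
move=> sl /torusP[t1 t2]; have := @lin_le_sup R a b 1 y (0, 0) sl; rewrite /= !subr0.
have lin0 : lin a b (0, 0) = 0 :> R by rewrite /lin/=; ring.
by rewrite lin0 subr0 mulr1; apply; rewrite ger0_norm; move: t1 t2; clear; lra.
Qed.

Lemma level_le3 (u ga v : R) : `|u - ga| <= v -> v <= 1 -> `|u| <= 2 -> `|ga| <= 3.
Proof.
by rewrite !ler_norml => /andP[? ?] ? /andP[? ?]; apply/andP; split; lra.
Qed.

End Rounding.

(** * Probabilities of the exceptional events *)

Section Events.
Context {d : measure_display} {T : measurableType d} {R : realType}
  (P : probability T R) (xi : nat -> {RV P >-> (R * R)%type}) (x : nat -> R * R).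
Hypothesis indep : independent_RVs xi.
Hypothesis unif : forall n, uniform_torus (xi n).
Hypothesis x_torus : forall n, torus (x n).

Let c (w : T) (n : nat) : R * R := torus_add (xi n w) (x n).

Lemma union_bound (I : finType) (E : I -> set T) (r : R) :
  (forall i, measurable (E i)) -> (forall i, (P (E i) <= r%:E)%E) ->
  measurable (\bigcup_i E i) /\ (P (\bigcup_i E i) <= (#|I|%:R * r)%:E)%E.
Proof.
move=> mE PE.
have -> : \bigcup_i E i = \big[setU/set0]_(i <- enum I) E i.
  rewrite -bigcup_seq; apply/seteqP; split => w [i _ Ew]; exists i => //=.
  by rewrite mem_enum.
have H (s : seq I) : measurable (\big[setU/set0]_(i <- s) E i) /\
   (P (\big[setU/set0]_(i <- s) E i) <= ((size s)%:R * r)%:E)%E.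
  elim: s => [|i s [ih1 ih2]]; first by rewrite big_nil measure0 mul0r.
  rewrite big_cons; split; first exact: measurableU.
  rewrite (le_trans (measureU2 P (mE i) ih1))//= -natr1 mulrDl mul1r addrC EFinD.
  exact: leeD.
by have := H (enum I); rewrite -cardE.
Qed.

Lemma indep_bound (s : seq nat) (B : nat -> set (R * R)) (r : R) :
  uniq s -> (forall n, measurable (B n)) ->
  (forall n, (P (xi n @^-1` B n) <= r%:E)%E) ->
  measurable (\bigcap_(n in [set` s]) (xi n @^-1` B n)) /\
  (P (\bigcap_(n in [set` s]) (xi n @^-1` B n)) <= (r ^+ size s)%:E)%E.
Proof.
move=> us mB PB.
have mX n : measurable (xi n @^-1` B n).
  by rewrite -[_ @^-1` _]setTI; exact: measurable_funP.
have r0 : 0 <= r by rewrite -lee_fin; apply: le_trans (PB 0%N).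
split; first by apply: bigcap_measurableType => n _; exact: mX.
have -> : [set` s] = [set` [fset n in s]%fset] by apply/seteqP; split => n /=; rewrite inE.
rewrite indep//.
have -> : size s = size (enum_fset [fset n in s]%fset).
  by have := card_fseq s; rewrite undup_id.
elim: (enum_fset _) => [|n s' ih]; first by rewrite big_nil expr0.
rewrite big_cons /= exprS EFinM; apply: lee_pmul => //.
by apply: prode_ge0.
Qed.

Lemma xi_prob n (B : set (R * R)) : measurable B ->
  P (xi n @^-1` B) = area (B `&` torus).
Proof. by move=> mB; have [_ h] := unif n; rewrite /area -h. Qed.

Lemma c_torus w n : torus (c w n).
Proof. by apply/torusP; split; exact: frac_itv. Qed.

(** The centre is a translate of [xi n] on the torus; a box of a quarter of the
area of the cell, contained in the preimage of the cell, is removed. *)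
Lemma cell_event (H i j n : nat) : (i < H)%N -> (j < H)%N ->
  exists B : set (R * R), [/\ measurable B,
    (P (xi n @^-1` B) <= (1 - ((2 * H%:R) ^+ 2)^-1)%:E)%E &
    forall w, ~ cell H i j (c w n) -> B (xi n w)].
Proof.
move=> iH jH; have /torusP[x1 x2] := x_torus n.
have [lo1 [h1 h1' hc1]] := frac_cell_preimage iH x1.
have [lo2 [h2 h2' hc2]] := frac_cell_preimage jH x2.
set e : R := (2 * H%:R)^-1 in h1' h2' hc1 hc2.
have e0 : 0 <= e by rewrite invr_ge0 mulr_ge0.
pose box := `[lo1, lo1 + e[%classic `*` `[lo2, lo2 + e[%classic.
have mbox : measurable box by exact: measurableX.
exists (~` box); split; first exact: measurableC.
  have mX : measurable (xi n @^-1` box).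
    by rewrite -[_ @^-1` _]setTI; exact: measurable_funP.
  rewrite -preimage_setC probability_setC// xi_prob//.
  have -> : box `&` torus = box.
    apply/setIidPl => y [/= + +]; rewrite !in_itv/= => ? ?.
    by apply/torusP; split; lra.
  by rewrite area_box// -EFinB lee_fin -exprVn expr2.
move=> w nc [/= + +]; rewrite !in_itv/= => b1 b2; apply: nc.
by split; [exact: hc1|exact: hc2].
Qed.

Lemma frac_sub (a b : R) : 0 <= a < 1 -> 0 <= b < 1 ->
  exists e : bool, frac (a + b) = a + b - e%:R.
Proof.
move=> ha hb; have [h|h] := ltP (a + b) 1.
  by exists false; rewrite frac_id ?subr0//; lra.
by exists true; rewrite frac_sub1//; lra.
Qed.

(** Modulo the lattice the translate of [xi n] is one of four plane translates,
and each sends the strip to a strip. *)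
Lemma strip_event (K v al be ga : R) (n : nat) : 0 < K -> 0 <= v ->
  al = K \/ be = K ->
  exists B : set (R * R), [/\ measurable B,
    (P (xi n @^-1` B) <= (4 * (2 * v / K))%:E)%E &
    forall w, `|lin al be (c w n) - ga| <= v -> B (xi n w)].
Proof.
move=> K0 v0 hK; have /torusP[x1 x2] := x_torus n.
pose S (e : bool * bool) :=
  strip al be (ga - lin al be (x n) + al * e.1%:R + be * e.2%:R) v.
have mS e : measurable (S e) by exact: measurable_strip.
have mX e : measurable (xi n @^-1` S e).
  by rewrite -[_ @^-1` _]setTI; exact: measurable_funP.
have PS e : (P (xi n @^-1` S e) <= (2 * v / K)%:E)%E.
  rewrite xi_prob//; case: hK => hK; rewrite -hK in K0 *.
    exact: area_strip1.
  exact: area_strip2.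
exists (\bigcup_e S e); split.
- by apply: fin_bigcup_measurable => //; exact: finite_finset.
- rewrite preimage_bigcup.
  by have [_] := union_bound mX PS; rewrite card_prod card_bool.
- move=> w; have [xt _] := unif n; have /torusP[t1 t2] := xt w.
  have [e1 E1] := frac_sub t1 x1; have [e2 E2] := frac_sub t2 x2.
  rewrite /c /torus_add {1}/lin/= E1 E2 => h; exists (e1, e2) => //.
  rewrite /S /strip /lin/=; move: h; congr (`|_| <= _); ring.
Qed.

Lemma spread_event (L m h : nat) :
  exists E : set T, [/\ measurable E,
    (P E <= ((h ^ L * h ^ L)%:R * (1 - ((2 * (h ^ L)%:R) ^+ 2)^-1) ^+ (h ^ L.*2.+1))%:E)%E &
    forall w, ~ E w -> spread (c w) L m h].
Proof.
set H := (h ^ L)%N; set n0 := (h ^ L.*2.+1)%N.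
pose q n (p : 'I_H * 'I_H) := cell_event n (ltn_ord p.1) (ltn_ord p.2).
pose B n p := projT1 (cid (q n p)).
have BP n p := projT2 (cid (q n p)).
pose E p := \bigcap_(n in [set` iota m n0]) (xi n @^-1` B n p).
pose r : R := (1 - ((2 * H%:R) ^+ 2)^-1) ^+ n0.
have [mE PE] : (forall p, measurable (E p)) /\ (forall p, (P (E p) <= r%:E)%E).
  suff HH p : measurable (E p) /\ (P (E p) <= r%:E)%E.
    by split=> p; have [] := HH p.
  rewrite /r -[in _ ^+ n0](size_iota m n0).
  apply: (indep_bound (iota_uniq m n0)) => n.
    by have [] := BP n p.
  by have [_ ? _] := BP n p.
have [mU PU] := union_bound mE PE.
exists (\bigcup_p E p); split => //.
  by move: PU; rewrite card_prod !card_ord.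
move=> w nE i j iH jH.
apply: contrapT => /forallNP nc; apply: nE.
exists (Ordinal iH, Ordinal jH) => // n /=; rewrite mem_iota => /andP[mn nm].
have [_ _] := BP n (Ordinal iH, Ordinal jH); apply => /=.
have nn : (n - m < n0)%N by rewrite ltn_subLR.
by have := nc (Ordinal nn); rewrite /= subnKC.
Qed.

(** If a strip contains more than [M] centres, some [M] of them lie in a common
strip of the net; the union runs over the net and the [M]-tuples of indices. *)
Lemma dispersed_event (L M m h : nat) : (0 < h)%N ->
  exists E : set T, [/\ measurable E,
    (P E <= ((2 * (2 * 1 * h ^ L.*2.+2).+1 * (2 * 3 * h ^ L.*2.+2).+1 * (h ^ L.*2.+1) ^ M)%:R
       * (24 / (h ^ L.*2.+2)%:R) ^+ M)%:E)%E &
    forall w, ~ E w -> dispersed (c w) L M m h].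
Proof.
move=> h0.
set K := (h ^ L.*2.+2)%N; set n0 := (h ^ L.*2.+1)%N.
have K0' : (0 < K)%N by rewrite expn_gt0 h0.
have K0 : 0 < K%:R :> R by rewrite ltr0n.
have netK b j : net_coef K b j = K%:R :> R \/ net_coef K (~~ b) j = K%:R :> R.
  by case: b; [left|right].
pose q n (b : bool) (j g : nat) :=
  strip_event (g%:R - 3 * K%:R) n K0 (ler0n _ 3) (netK b j).
pose B n b j g := projT1 (cid (q n b j g)).
have BP n b j g := projT2 (cid (q n b j g)).
pose I : finType :=
  (bool * 'I_(2 * 1 * K).+1 * 'I_(2 * 3 * K).+1 * M.-tuple 'I_n0)%type.
(* Only tuples of distinct indices count, for which independence applies. *)
pose E (i : I) : set T := let: (b, j, g, t) := i in
  if uniq t then \bigcap_(n in [set` [seq (m + val n)%N | n : 'I_n0 <- t]])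
    (xi n @^-1` B n b j g) else set0.
pose r : R := (24 / K%:R) ^+ M.
have r0 : 0 <= r by rewrite exprn_ge0// divr_ge0.
have [mE PE] : (forall i, measurable (E i)) /\ (forall i, (P (E i) <= r%:E)%E).
  suff HH i : measurable (E i) /\ (P (E i) <= r%:E)%E.
    by split=> i; have [] := HH i.
  case: i => [[[b j] g] t]; rewrite /E; case: ifP => ut; last first.
    by rewrite measure0.
  have -> : r = (24 / K%:R) ^+ size [seq (m + val n)%N | n : 'I_n0 <- t].
    by rewrite size_map size_tuple.
  apply: indep_bound => [|n|n].
  - by rewrite map_inj_uniq// => u v /addnI/val_inj.
  - by have [] := BP n b j g.
  - by have [_ + _] := BP n b j g; move=> /le_trans; apply; rewrite lee_fin; lra.
have [mU PU] := union_bound mE PE.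
exists (\bigcup_i E i); split => //.
  by move: PU; rewrite !card_prod card_bool !card_ord card_tuple card_ord.
move=> w nE a b ga sl; rewrite leqNgt; apply/negP => big; apply: nE.
set A := [pred n | _] in big.
have K1 : K%:R^-1 <= 1 :> R by rewrite invf_le1// ler1n.
have ga3 : `|ga| <= 3.
  have /card_gt0P[n] : (0 < #|A|)%N by apply: leq_ltn_trans big.
  by rewrite inE/= => hn; exact: level_le3 hn K1 (lin_torus_le2 sl (c_torus w (m + n)%N)).
have tsize : size (take M (enum A)) == M.
  by rewrite size_take -cardE big.
have [bb [j [g hj]]] := strip_in_net K0' sl ga3.
exists (bb, j, g, Tuple tsize) => //=.
rewrite take_uniq ?enum_uniq// => n /= /mapP[n' /mem_take].
rewrite mem_enum inE /= => hn' ->.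
have [_ _] := BP (m + n')%N bb j g; apply; apply: hj => //.
exact: c_torus.
Qed.

End Events.

(** * Almost surely there are good scales *)

Section AlmostSure.
Context {d : measure_display} {T : measurableType d} {R : realType}
  (P : probability T R) (xi : nat -> {RV P >-> (R * R)%type}) (x : nat -> R * R).
Hypothesis indep : independent_RVs xi.
Hypothesis unif : forall n, uniform_torus (xi n).
Hypothesis x_torus : forall n, torus (x n).

Let c (w : T) (n : nat) : R * R := torus_add (xi n w) (x n).

(** With [H = h ^ L], the power is at most [exp (- h / 4)], which beats the number
[H ^ 2] of cells by the term of degree [2 L + 1] of the exponential series. *)
Lemma spread_bound (L : nat) : exists C : R, forall h : nat, (0 < h)%N ->
  (h ^ L * h ^ L)%:R * (1 - ((2 * (h ^ L)%:R) ^+ 2)^-1) ^+ (h ^ L.*2.+1) <= C / h%:R.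
Proof.
exists ((L.*2.+1)`!%:R * 4 ^+ L.*2.+1) => h h0.
have h0' : 0 < h%:R :> R by rewrite ltr0n.
have HH : (h ^ L * h ^ L)%:R = h%:R ^+ L.*2 :> R by rewrite -expnD addnn natrX.
set y : R := ((2 * (h ^ L)%:R) ^+ 2)^-1.
have yE : y = (4 * h%:R ^+ L.*2)^-1.
  by rewrite /y exprMn natrX -exprM muln2; congr (_ * _)^-1; ring.
have E1 : (1 - y) ^+ (h ^ L.*2.+1) <= expR (- (h%:R / 4)).
  apply: (@le_trans _ _ (expR (- y) ^+ (h ^ L.*2.+1))).
    apply: lerXn2r; rewrite ?nnegrE ?expR_ge0//; last exact: expR_ge1Dx.
    rewrite subr_ge0 yE invf_le1 ?mulr_gt0 ?exprn_gt0//.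
    have : 1 <= h%:R ^+ L.*2 :> R by rewrite exprn_ege1// ler1n.
    lra.
  rewrite -expRM_natl ler_expR yE natrX exprS.
  by rewrite le_eqVlt; apply/orP; left; apply/eqP; field; rewrite ?gt_eqF ?exprn_gt0.
have E2 : (h%:R / 4) ^+ L.*2.+1 / (L.*2.+1)`!%:R <= expR (h%:R / 4) :> R.
  have := @expR_ge1Dxn R (h%:R / 4) L.*2 (divr_ge0 (ltW h0') (ler0n _ 4)).
  by apply: le_trans; rewrite lerDr.
have f0 : 0 < (L.*2.+1)`!%:R :> R by rewrite ltr0n fact_gt0.
rewrite HH; apply: (@le_trans _ _ (h%:R ^+ L.*2 * expR (- (h%:R / 4)))).
  by rewrite ler_wpM2l// exprn_ge0// ltW.
rewrite expRN ler_pdivrMr ?expR_gt0//.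
apply: le_trans (ler_wpM2l _ E2); last first.
  by rewrite !mulr_ge0// ?invr_ge0 ?exprn_ge0// ltW.
rewrite expr_div_n (exprS h%:R) le_eqVlt; apply/orP; left; apply/eqP.
have : (4 : R) ^+ L.*2.+1 != 0 by rewrite expf_neq0.
move: (4 ^+ L.*2.+1) (h%:R ^+ L.*2) => u v u0.
by field; rewrite u0 !gt_eqF.
Qed.

(** The net has [O(h ^ (4 L + 4))] strips and each tuple contributes a factor
[O(1 / h)] per index; hence the choice of [4 L + 5] indices. *)
Lemma dispersed_bound (L : nat) : exists C : R, forall h : nat, (0 < h)%N ->
  (2 * (2 * 1 * h ^ L.*2.+2).+1 * (2 * 3 * h ^ L.*2.+2).+1 *
     (h ^ L.*2.+1) ^ (4 * L + 5))%:R
    * (24 / (h ^ L.*2.+2)%:R) ^+ (4 * L + 5) <= C / h%:R.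
Proof.
exists (42 * 24 ^+ (4 * L + 5)) => h h0.
set M := (4 * L + 5)%N; set K := (h ^ L.*2.+2)%N.
have h0' : 0 < h%:R :> R by rewrite ltr0n.
have K0 : 0 < K%:R :> R by rewrite ltr0n expn_gt0 h0.
have K1 : (0 < K)%N by rewrite expn_gt0 h0.
apply: (@le_trans _ _ ((42 * K ^ 2 * (h ^ L.*2.+1) ^ M)%:R * (24 / K%:R) ^+ M)).
  rewrite ler_wpM2r ?exprn_ge0 ?divr_ge0 ?(ltW K0)// ler_nat leq_mul2r.
  by apply/orP; right; nia.
rewrite le_eqVlt; apply/orP; left; apply/eqP.
have KE : K%:R = h%:R ^+ L.*2.+1 * h%:R :> R by rewrite /K natrX exprSr.
have e1 : K%:R ^+ 2 * h%:R = h%:R ^+ M :> R.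
  by rewrite /K natrX -exprM -exprSr; congr (_ ^+ _); rewrite /M; lia.
clearbody K; rewrite !natrM !natrX expr_div_n.
rewrite [in X in _ * (_ / X)]KE exprMn -e1.
have : (h%:R ^+ L.*2.+1) ^+ M != 0 :> R by rewrite !expf_neq0 ?gt_eqF.
move: ((h%:R ^+ L.*2.+1) ^+ M) (24 ^+ M) => u v u0.
by field; rewrite u0 !gt_eqF.
Qed.

Lemma good_event (L : nat) : exists C : R, forall m h : nat, (0 < h)%N ->
  exists E : set T, [/\ measurable E, (P E <= (C / h%:R)%:E)%E &
    forall w, ~ E w -> spread (c w) L m h /\ dispersed (c w) L (4 * L + 5) m h].
Proof.
have [C1 h1] := spread_bound L; have [C2 h2] := dispersed_bound L.
exists (C1 + C2) => m h h0.
have [E1 [mE1 PE1 E1s]] := spread_event indep unif x_torus L m h.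
have [E2 [mE2 PE2 E2s]] := dispersed_event indep unif x_torus L (4 * L + 5) m h0.
exists (E1 `|` E2); split; first exact: measurableU.
  rewrite (le_trans (measureU2 P mE1 mE2))// mulrDl EFinD leeD//.
    by apply: le_trans PE1 _; rewrite lee_fin h1.
  by apply: le_trans PE2 _; rewrite lee_fin h2.
by move=> w /not_orP[nE1 nE2]; split; [exact: E1s|exact: E2s].
Qed.

(** The absence of good scales beyond [h0] is contained in one exceptional event for
each [h] at which the radii are large enough, and the probabilities [O(1 / h)] of
these events are arbitrarily small. *)
Lemma ae_good_scale (delta : nat -> R) (L a n1 : nat) :
  (forall m h0, (n1 <= m)%N -> exists2 h, (h0 <= h)%N &
     forall n, (m <= n < m + h ^ L.*2.+1)%N -> (h%:R ^+ a)^-1 <= delta n) ->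
  {ae P, forall w, forall m h0, (n1 <= m)%N ->
     exists2 h, (h0 <= h)%N & good_scale (c w) delta L a (4 * L + 5) m h}.
Proof.
move=> hdelta; have [C hC] := good_event L.
pose scale m h := forall n, (m <= n < m + h ^ L.*2.+1)%N -> (h%:R ^+ a)^-1 <= delta n.
pose bad m h0 := [set w | (n1 <= m)%N /\ forall h, (h0 <= h)%N ->
  ~ good_scale (c w) delta L a (4 * L + 5) m h].
suff neg m h0 : P.-negligible (bad m h0).
  have := negligible_bigcup (fun m => negligible_bigcup (neg m)).
  apply: negligibleS => w /= /existsNP[m] /existsNP[h0] /not_implyP[n1m H].
  exists m => //; exists h0 => //; split => // h hh B.
  by apply: H; exists h.
have [n1m|mn1] := leqP n1 m; last first.
  rewrite (_ : bad m h0 = set0); first exact: negligible_set0.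
  by apply/seteqP; split => // w [/=]; rewrite leqNgt mn1.
(* A single scale beyond [k] already forces the probability to be small. *)
have small k : exists E : set T, [/\ measurable E, bad m h0 `<=` E &
    (P E <= (`|C| / k.+1%:R)%:E)%E].
  have [h hh sc] := hdelta m (maxn h0 k.+1) n1m.
  have kh : (k < h)%N by apply: leq_trans hh; rewrite leq_maxr.
  have [E [mE PE hE]] := hC m h (leq_ltn_trans (leq0n k) kh).
  exists E; split => //.
    move=> w [_ H]; apply: contrapT => /hE[hs hd].
    by apply: (H h); [exact: leq_trans (leq_maxl _ _) hh|split].
  apply: le_trans PE _; rewrite lee_fin.
  have h0' : 0 < h%:R :> R by rewrite ltr0n (leq_ltn_trans _ kh).
  apply: (@le_trans _ _ (`|C| / h%:R)).
    by rewrite ler_wpM2r ?invr_ge0 ?(ltW h0')// ler_norm.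
  by rewrite ler_wpM2l// lef_pV2 ?posrE// ler_nat.
pose E k := projT1 (cid (small k)); have EP k := projT2 (cid (small k)).
exists (\bigcap_k E k); split.
- by apply: bigcap_measurableType => k _; have [] := EP k.
- apply/eqP; rewrite eq_le measure_ge0 andbT.
  apply/lee_addgt0Pr => e e0; rewrite add0e.
  pose k := Num.truncn (`|C| / e).
  have [mE _ PE] := EP k.
  apply: (@le_trans _ _ (P (E k))).
    apply: le_measure; rewrite ?inE//.
      by apply: bigcap_measurableType => j _; have [] := EP j.
    by move=> w; apply.
  apply: le_trans PE _; rewrite lee_fin ler_pdivrMr// mulrC -ler_pdivrMr//.
  by rewrite ltW// truncnS_gt.
- by move=> w hw k _; have [_ + _] := EP k; apply.
Qed.

End AlmostSure.

(** * Radii at infinitely many scales *)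

Section Scales.
Context {R : realType}.

Lemma limn_esup_gt (u : nat -> \bar R) (s : \bar R) (N0 : nat) :
  (s < limn_esup u)%E -> exists2 N, (N0 <= N)%N & (s < u N)%E.
Proof.
move=> su; apply: contrapT => H.
move: su; apply/negP; rewrite -leNgt.
apply: (@le_trans _ _ (ereal_sup (u @` [set n | (N0 <= n)%N]))).
  by apply: ereal_inf_lbound; exists [set n | (N0 <= n)%N] => //; exists N0.
apply: ge_ereal_sup => _ [n /= nN0 <-]; rewrite leNgt; apply/negP => sn.
by apply: H; exists n.
Qed.

Lemma limn_esup_lt (u : nat -> \bar R) (s : \bar R) :
  (limn_esup u < s)%E -> \forall n \near \oo, (u n < s)%E.
Proof.
move=> /ereal_inf_lt[_ [V FV <-]] Vs.
move: FV; apply: filterS => n Vn; apply: le_lt_trans Vs.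
by apply: ereal_sup_ubound; exists n.
Qed.

Lemma nat_root (p Y : nat) : (0 < p)%N ->
  exists h, (h ^ p <= Y)%N /\ (Y < h.+1 ^ p)%N.
Proof.
move=> p0; have ex : exists h, (h ^ p <= Y)%N by exists 0%N; rewrite exp0n.
have bd h : (h ^ p <= Y)%N -> (h <= Y)%N.
  apply: leq_trans; case: h => // h.
  by rewrite -[leqLHS]expn1 leq_pexp2l.
case: (ex_maxnP ex bd) => h hY hmax; exists h; split=> //.
by rewrite ltnNge; apply/negP => /hmax; rewrite ltnn.
Qed.

(** Where the quotient is close to 1 it is nonzero, which forces [rho n] to be
positive since [ln] vanishes on nonpositive numbers. *)
Lemma ln_ratio_near (rho delta : nat -> R) :
  rho @ \oo --> 0 ->
  (fun n => ln (rho n) / ln (delta n)) @ \oo --> (1 : R) ->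
  forall e, 1 < e -> \forall n \near \oo,
    [/\ 0 < rho n < 1, ln (rho n) < 0 & e * ln (rho n) <= ln (delta n)].
Proof.
move=> rho0 ratio e e1.
have e0 : 0 < e by apply: lt_trans e1.
have rho1 : \forall n \near \oo, rho n < 1.
  exact: (@cvgr_lt _ _ _ _ _ _ rho0 _ ltr01).
have r1 : \forall n \near \oo, e^-1 < ln (rho n) / ln (delta n).
  by apply: (@cvgr_gt _ _ _ _ _ _ ratio); rewrite invf_lt1.
near=> n.
have h1 : rho n < 1 by near: n.
have h2 : e^-1 < ln (rho n) / ln (delta n) by near: n.
have h0 : 0 < ln (rho n) / ln (delta n) by apply: lt_trans h2; rewrite invr_gt0.
have rp : 0 < rho n.
  by rewrite ltNge; apply/negP => r; move: h0; rewrite (ln0 r) mul0r ltxx.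
have ln_lt : ln (rho n) < 0 by apply: ln_lt0; rewrite rp.
have lnd : ln (delta n) < 0.
  by move: h0; rewrite nmulr_rgt0// invr_lt0.
split => //; first by rewrite rp.
by move: h2; rewrite ltr_ndivlMr// => /ltW; rewrite ler_pdivlMl.
Unshelve. all: by end_near. Qed.

(** Here [e] absorbs the ratio of the logarithms of diameters and radii. The
bound on [a * t0] asks for [2 L (e * t0 / s) < 2 L] up to bounded terms. *)
Lemma exists_admissible (t0 s e : R) : 0 < t0 < 1 -> 0 < s <= 1 -> 1 < e ->
  e * t0 < s ->
  exists L a, admissible t0 L a /\ e / s * L.*2.+2%:R <= a%:R.
Proof.
move=> /andP[t00 t01] /andP[s0 s1] e1 es.
pose k := e * t0 / s.
have k1 : k < 1 by rewrite /k ltr_pdivrMr// mul1r.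
have k0 : 0 < k by rewrite /k divr_gt0// mulr_gt0// (lt_trans _ e1).
pose L := maxn (Num.truncn (2 / (1 - k))).+1 (Num.truncn (3 / (1 - t0))).+1.
have L1 : 2 <= L%:R * (1 - k).
  rewrite -ler_pdivrMr ?subr_gt0//; apply: le_trans (ltW (truncnS_gt _)) _.
  by rewrite ler_nat leq_maxl.
have L2 : 3 <= L%:R * (1 - t0).
  rewrite -ler_pdivrMr ?subr_gt0//; apply: le_trans (ltW (truncnS_gt _)) _.
  by rewrite ler_nat leq_maxr.
have y0 : 0 <= e / s * L.*2.+2%:R.
  by rewrite mulr_ge0// divr_ge0// ltW// (lt_trans _ e1).
pose a := (Num.truncn (e / s * L.*2.+2%:R)).+1.
have aub : a%:R <= e / s * L.*2.+2%:R + 1.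
  by rewrite /a -natr1 lerD2r; have /andP[] := truncn_itv y0.
have alb : e / s * L.*2.+2%:R <= a%:R by rewrite ltW// truncnS_gt.
have E2 : L.*2.+2%:R = 2 * L%:R + 2 :> R by rewrite -addn2 natrD -mul2n natrM.
exists L, a; split => //; split => //.
  have : a%:R * t0 <= (e / s * L.*2.+2%:R + 1) * t0 by rewrite ler_pM2r.
  have -> : (e / s * L.*2.+2%:R + 1) * t0 = k * (2 * L%:R + 2) + t0.
    by rewrite E2 /k; field; rewrite gt_eqF.
  rewrite -mul2n natrM; lra.
rewrite -(ler_nat R); apply: le_trans alb.
have es1 : 1 <= e / s by rewrite ler_pdivlMr// mul1r (le_trans s1)// ltW.
have : 1 * L.*2.+2%:R <= e / s * L.*2.+2%:R by rewrite ler_wpM2r.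
have : 0 <= L%:R :> R by []. lra.
Qed.

(** If the ratio that defines the limsup exceeds [s] at [N], then [rho N] is at least
[(N + 1) ^ (- 1 / s)], and by monotonicity so are the [rho n] for [n <= N].
The scale [h] is the integer root of order [2 L + 1] of the number of indices
between [m] and [N]. *)
Lemma scales_radius (rho delta : nat -> R) (t0 s : R) :
  nonincreasing_seq rho -> rho @ \oo --> 0 ->
  (fun n => ln (rho n) / ln (delta n)) @ \oo --> (1 : R) ->
  (forall n, 0 < delta n) ->
  0 < t0 < s -> s < 1 ->
  (s%:E < limn_esup (fun n => (ln n.+1%:R / - ln (rho n))%:E))%E ->
  exists L a n1, admissible t0 L a /\
    forall m h0, (n1 <= m)%N -> exists2 h, (h0 <= h)%N &
      forall n, (m <= n < m + h ^ L.*2.+1)%N -> (h%:R ^+ a)^-1 <= delta n.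
Proof.
move=> rho_dec rho0 ratio delta0 /andP[t00 t0s] s1 hs.
have s0 : 0 < s by apply: lt_trans t0s.
(* Any [e] with [1 < e < s / t0] will do. *)
pose e := (1 + s / t0) / 2.
have st : 1 < s / t0 by rewrite ltr_pdivlMr// mul1r.
have e1 : 1 < e by rewrite /e; lra.
have es : e * t0 < s.
  have -> : e * t0 = (t0 + s) / 2 by rewrite /e; field; rewrite gt_eqF.
  lra.
have ht0 : 0 < t0 < 1 by rewrite t00 (lt_trans t0s).
have hs1 : 0 < s <= 1 by rewrite s0 ltW.
have [L [a [adm ha]]] := exists_admissible ht0 hs1 e1 es.
have [n1 _ hn1] := ln_ratio_near rho0 ratio e1.
exists L, a, n1; split => // m h0 n1m.
pose p := L.*2.+1.
pose h1 := maxn (maxn h0 (4 ^ p)) 1.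
have [N NN sN] := limn_esup_gt (2 * m + h1.+1 ^ p)%N hs.
have mN : (2 * m <= N)%N by apply: leq_trans NN; rewrite leq_addr.
have mN1 : (m <= N.+1)%N by clear -mN; lia.
have h1_h0 : (h0 <= h1)%N by rewrite /h1 -maxnA leq_maxl.
have h1_4 : (4 ^ p <= h1)%N by rewrite /h1 maxnAC leq_maxr.
have h1_gt0 : (0 < h1)%N by rewrite /h1 leq_maxr.
have [h [hY Yh]] := @nat_root p (N.+1 - m)%N isT.
have h1h : (h1 <= h)%N.
  have : (h1.+1 ^ p < h.+1 ^ p)%N.
    apply: leq_ltn_trans Yh; rewrite leq_subRL//.
    apply: leq_trans (leq_trans NN (leqnSn N)); rewrite leq_add2r.
    by rewrite leq_pmull.
  by rewrite ltn_exp2r// ltnS => /ltnW.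
have h_gt0 : (0 < h)%N by apply: leq_trans h1h.
have N_le : (N.+1 <= h ^ p.+1)%N.
  have N2 : (N.+1 <= 2 * (N.+1 - m))%N by clear -mN; lia.
  apply: (leq_trans N2).
  apply: (@leq_trans ((2 * h.+1) ^ p)%N).
    rewrite expnMn; apply: leq_mul; last exact: ltnW.
    by rewrite -[leqLHS]expn1 leq_pexp2l.
  apply: (@leq_trans ((4 * h) ^ p)%N).
    by rewrite leq_exp2r//; clear -h_gt0; lia.
  rewrite expnMn expnS; apply: leq_mul => //.
  exact: leq_trans h1h.
exists h; first exact: leq_trans h1h.
move=> n /andP[mn nmh].
have nN : (n <= N)%N.
  by rewrite -ltnS; apply: (leq_trans nmh); rewrite -leq_subRL.
have [/andP[rn0 rn1] lrn hd] := hn1 n (leq_trans n1m mn).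
have [/andP[rN0 rN1] lrN _] := hn1 N (leq_trans (leq_trans n1m mn) nN).
have h1' : 1 <= h%:R :> R by rewrite ler1n.
have hp : 0 < h%:R :> R by rewrite ltr0n.
have lnh : 0 <= ln h%:R :> R by exact: ln_ge0.
have e0 : 0 < e by apply: lt_trans e1.
have lnN : - ln (rho N) <= ln N.+1%:R / s.
  move: sN; rewrite lte_fin ltr_pdivlMr ?oppr_gt0// => /ltW.
  by rewrite ler_pdivlMr// mulrC.
have lnNh : ln N.+1%:R <= L.*2.+2%:R * ln h%:R :> R.
  rewrite mulr_natl -lnXn// ler_ln ?posrE ?exprn_gt0//.
  by rewrite -natrX ler_nat.
have lnrho : ln (rho N) <= ln (rho n) by rewrite ler_ln ?posrE//; exact: rho_dec.
rewrite -ler_ln ?posrE ?invr_gt0 ?exprn_gt0// lnV ?posrE ?exprn_gt0//.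
rewrite lnXn// -[ln _ *+ a]mulr_natl.
have A1 : e * ln (rho N) <= ln (delta n).
  by apply: le_trans hd; rewrite ler_pM2l.
have A2 : e * - ln (rho N) <= e * (ln N.+1%:R / s) by rewrite ler_pM2l.
have A3 : e * (ln N.+1%:R / s) <= e / s * (L.*2.+2%:R * ln h%:R).
  rewrite (_ : e * _ = e / s * ln N.+1%:R); last by ring.
  by rewrite ler_wpM2l// divr_ge0// ltW.
have A4 : e / s * (L.*2.+2%:R * ln h%:R) <= a%:R * ln h%:R.
  by rewrite mulrA ler_wpM2r.
lra.
Qed.

End Scales.

(** * Distances on the torus and projections *)

Section Upper.
Context {R : realType}.

(** Discrete form of comparing the series of [n ^ (- (q + 1))] with an integral,
from [ln (1 + 1 / y) >= 1 / (y + 1)]. *)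
Lemma tail_step (y q : R) : 0 < y -> 0 < q ->
  q * (y + 1) `^ (- (q + 1)) <= y `^ (- q) - (y + 1) `^ (- q).
Proof.
move=> y0 q0; have y10 : 0 < y + 1 by rewrite addr_gt0.
have -> : (y + 1) `^ (- (q + 1)) = (y + 1) `^ (- q) / (y + 1).
  rewrite opprD powRD; last by apply/implyP => _; rewrite gt_eqF.
  by rewrite powR_inv1// ltW.
have h1 : (y + 1)^-1 <= ln (y + 1) - ln y.
  rewrite -ln_div ?posrE// -[leLHS]opprK lerNl -lnV ?posrE ?divr_gt0// invf_div.
  have -> : y / (y + 1) = 1 + - (y + 1)^-1 by field; rewrite gt_eqF.
  by apply: le_ln1Dx; rewrite ltrN2 invf_lt1// ltrDr.
have h2 : y `^ (- q) = (y + 1) `^ (- q) * expR (q * (ln (y + 1) - ln y)).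
  by rewrite /powR !gt_eqF// -expRD; congr expR; ring.
have h3 : 1 + q / (y + 1) <= expR (q * (ln (y + 1) - ln y)).
  by apply: le_trans (expR_ge1Dx _); rewrite lerD2l ler_pM2l.
have := ler_wpM2l (powR_ge0 (y + 1) (- q)) h3; rewrite -h2; lra.
Qed.

Lemma tail_series (m : nat) (p : R) : (0 < m)%N -> 1 < p ->
  (\sum_(0 <= i <oo) ((m + i).+1%:R `^ (- p))%:E <=
     (m%:R `^ (- (p - 1)) / (p - 1))%:E)%E.
Proof.
move=> m0 p1; set q := p - 1; have q0 : 0 < q by rewrite subr_gt0.
apply: lime_le.
  by apply: is_cvg_nneseries => n _ _; rewrite lee_fin powR_ge0.
apply: nearW => n; rewrite sumEFin lee_fin.
suff H : \sum_(0 <= i < n) (m + i).+1%:R `^ (- p) <=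
    (m%:R `^ (- q) - (m + n)%:R `^ (- q)) / q.
  apply: le_trans H _; rewrite ler_wpM2r ?invr_ge0 ?(ltW q0)//.
  by rewrite gerBl powR_ge0.
elim: n => [|n ih]; first by rewrite big_geq// addn0 subrr mul0r.
rewrite big_nat_recr//=.
have mn0 : 0 < (m + n)%:R :> R by rewrite ltr0n addn_gt0 m0.
have := tail_step mn0 q0; rewrite natr1 addnS (_ : q + 1 = p); last by rewrite /q subrK.
move: ih; rewrite !ler_pdivlMr// => ih hs; lra.
Qed.

Lemma frac_diff (a b : R) : exists k : int, frac a - frac b = a - b + k%:~R.
Proof.
exists (Num.floor b - Num.floor a); rewrite /frac intrB; ring.
Qed.

Lemma circle_dist_shift (u : R) (k : int) : `|u| < 1 ->
  Num.min `|u| (1 - `|u|) <= `|u + k%:~R|.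
Proof.
move=> u1; rewrite ge_min.
have [->|k0] := eqVneq k 0; first by rewrite addr0 lexx.
apply/orP; right.
have k1 : 1 <= `|k%:~R : R|.
  by rewrite -intr_norm -[leLHS]/(1%:~R) ler_int; lia.
have : `|k%:~R : R| <= `|u + k%:~R| + `|u|.
  by rewrite -{1}[k%:~R](addKr u) addrC (le_trans (ler_normD _ _))// normrN.
lra.
Qed.

(** Here [v] is a difference of two fractional parts in the same half of the unit
interval, so it is the shortest representative of its class modulo 1. *)
Lemma same_half_dist (u v : R) (k : int) : `|u| < 1 -> `|v| <= 1 / 2 ->
  v = u + k%:~R -> `|v| <= Num.min `|u| (1 - `|u|).
Proof.
move=> u1 v1 vE; rewrite le_min.
move: u1 v1; rewrite ltr_norml ler_norml => /andP[u1 u2] /andP[v1 v2].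
have [k0|[k1|k1]] : k = 0 \/ k = 1 \/ k = -1.
  have k2 : k%:~R < 2%:~R :> R by lra.
  have k3 : (- 2)%:~R < k%:~R :> R by rewrite rmorphN/=; lra.
  by move: k2 k3; rewrite !ltr_int; lia.
- move: vE; rewrite k0 addr0 => <-; rewrite lexx/=.
  have : `|v| <= 1 / 2 by rewrite ler_norml; apply/andP; split; lra.
  lra.
- move: vE; rewrite k1 => vE.
  by rewrite (ger0_norm (_ : 0 <= v)) ?(ler0_norm (_ : u <= 0)); [apply/andP; split; lra|lra|lra].
- move: vE; rewrite k1 rmorphN/= => vE.
  by rewrite (ler0_norm (_ : v <= 0)) ?(ger0_norm (_ : 0 <= u)); [apply/andP; split; lra|lra|lra].
Qed.

Lemma circle_dist_ge0 (x y : R) : 0 <= x < 1 -> 0 <= y < 1 -> 0 <= circle_dist x y.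
Proof.
move=> hx hy; rewrite /circle_dist le_min normr_ge0/= subr_ge0 ler_norml.
by apply/andP; split; lra.
Qed.

Lemma circle_dist_le1 (x y : R) : circle_dist x y <= 1.
Proof. by rewrite /circle_dist ge_min gerBl normr_ge0 orbT. Qed.

Lemma torus_dist_le (x y : R * R) (a b : R) : torus x -> torus y ->
  circle_dist x.1 y.1 <= a -> circle_dist x.2 y.2 <= b ->
  torus_dist x y <= Num.sqrt (a ^+ 2 + b ^+ 2).
Proof.
move=> /torusP[x1 x2] /torusP[y1 y2] ha hb.
rewrite /torus_dist; apply: ler_wsqrtr; apply: lerD.
  by apply: lerXn2r; rewrite ?nnegrE ?circle_dist_ge0// (le_trans _ ha)// circle_dist_ge0.
by apply: lerXn2r; rewrite ?nnegrE ?circle_dist_ge0// (le_trans _ hb)// circle_dist_ge0.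
Qed.

Lemma euclid_distE (x y : R * R) :
  euclid_dist x y = Num.sqrt ((x.1 - y.1) ^+ 2 + (x.2 - y.2) ^+ 2).
Proof. by rewrite /euclid_dist /dot /= !expr2. Qed.

Definition half (b : bool) (x : R) : bool := if b then x < 1 / 2 else 1 / 2 <= x.

Lemma circle_dist_half (b : bool) (xi x y : R) : 0 <= x < 1 -> 0 <= y < 1 ->
  half b (frac (xi + x)) -> half b (frac (xi + y)) ->
  `|frac (xi + x) - frac (xi + y)| <= circle_dist x y.
Proof.
move=> hx hy hbx hby; have [k E] := frac_diff (xi + x) (xi + y).
have fx := frac_itv (xi + x); have fy := frac_itv (xi + y).
apply: (@same_half_dist _ _ k).
- by rewrite ltr_norml; apply/andP; split; lra.
- by move: hbx hby; rewrite /half ler_norml; case: b => ? ?; apply/andP; split; lra.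
- by rewrite E; ring.
Qed.

Lemma dot_sqr (u v : R * R) : dot u v ^+ 2 <= dot u u * dot v v.
Proof.
rewrite -subr_ge0.
have -> : dot u u * dot v v - dot u v ^+ 2 = (u.1 * v.2 - u.2 * v.1) ^+ 2.
  by rewrite /dot; ring.
exact: sqr_ge0.
Qed.

Lemma dot_dir_gt0 (l : line R) : 0 < dot (line_dir l) (line_dir l).
Proof.
by rewrite lt_neqAle eq_sym dot_dir_neq0/= /dot -!expr2 addr_ge0// sqr_ge0.
Qed.

Lemma orth_projB (l : line R) (x y : R * R) :
  euclid_dist (orth_proj l x) (orth_proj l y) =
  Num.sqrt (dot (x - y) (line_dir l) ^+ 2 / dot (line_dir l) (line_dir l)).
Proof.
rewrite /euclid_dist; congr Num.sqrt.
have := dot_dir_neq0 l; rewrite /orth_proj.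
move: (line_dir l) (line_point l) => v p.
set D := dot v v => D0.
have DE : D = v.1 * v.1 + v.2 * v.2 by [].
apply: (@mulIf _ D) => //; rewrite divfK//.
rewrite {1}/dot /= /GRing.scale /=.
have -> : p.1 + dot (x - p) v / D * v.1 - (p.1 + dot (y - p) v / D * v.1) = dot (x - y) v / D * v.1.
  by rewrite /dot /=; field.
have -> : p.2 + dot (x - p) v / D * v.2 - (p.2 + dot (y - p) v / D * v.2) = dot (x - y) v / D * v.2.
  by rewrite /dot /=; field.
move: (dot (x - y) v) => w.
have -> : w / D * v.1 * (w / D * v.1) + w / D * v.2 * (w / D * v.2) = (w / D) ^+ 2 * D.
  by rewrite DE; ring.
by field.
Qed.

Lemma orth_proj_lip (l : line R) (x y : R * R) :
  euclid_dist (orth_proj l x) (orth_proj l y) <= euclid_dist x y.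
Proof.
rewrite orth_projB; apply: ler_wsqrtr; rewrite ler_pdivrMr ?dot_dir_gt0//.
exact: dot_sqr.
Qed.

End Upper.

(** * The covering argument for the upper bound *)

Section Cover.
Context {R : realType}.

Lemma hausdorff_gauge_ge0 (X : Type) (dist : X -> X -> R) (s : R) (U : set X) :
  (0 <= hausdorff_gauge dist s U)%E.
Proof. by rewrite /hausdorff_gauge; case: ifP => // _; exact: poweR_ge0. Qed.

Lemma hausdorff_content_ge0 (X : Type) (dist : X -> X -> R) (s e : R) (A : set X) :
  (0 <= hausdorff_content dist s e A)%E.
Proof.
apply: le_ereal_inf_tmp => _ [U _ <-].
by apply: nneseries_ge0 => *; exact: hausdorff_gauge_ge0.
Qed.

Lemma hausdorff_measure_eq0 (X : Type) (dist : X -> X -> R) (s : R) (A : set X) :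
  (forall delta e, 0 < delta -> 0 < e -> exists U : nat -> set X,
    [/\ A `<=` \bigcup_i U i, forall i, (diameter dist (U i) <= delta%:E)%E &
      (\sum_(0 <= i <oo) hausdorff_gauge dist s (U i) <= e%:E)%E]) ->
  hausdorff_measure dist s A = 0%E.
Proof.
move=> H; apply/eqP; rewrite eq_le; apply/andP; split; last first.
  apply: (@le_trans _ _ (hausdorff_content dist s 1 A)).
    exact: hausdorff_content_ge0.
  by apply: ereal_sup_ubound; exists 1 => //=.
apply: ge_ereal_sup => _ [delta /= d0 <-].
apply/lee_addgt0Pr => e e0; rewrite add0e.
have [U [AU dU sU]] := H delta e d0 e0.
by apply: le_trans sU; apply: ereal_inf_lbound; exists U.
Qed.

Lemma gauge_le (X : Type) (dist : X -> X -> R) (s r : R) (U : set X) :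
  0 <= s -> 0 <= r -> (forall x y, 0 <= dist x y) ->
  (forall x y, U x -> U y -> dist x y <= r) ->
  (hausdorff_gauge dist s U <= (r `^ s)%:E)%E.
Proof.
move=> s0 r0 dist0 dU; rewrite /hausdorff_gauge; case: asboolP => [_|].
  by rewrite lee_fin powR_ge0.
move=> /eqP/set0P[x Ux].
have dr : (diameter dist U <= r%:E)%E.
  by apply: ge_ereal_sup => _ [y Uy [z Uz <-]]; rewrite lee_fin dU.
have d0 : (0 <= diameter dist U)%E.
  apply: (@le_trans _ _ (dist x x)%:E); first by rewrite lee_fin.
  by apply: ereal_sup_ubound; exists x => //; exists x.
rewrite -poweR_EFin; apply: gt0_ler_poweR => //.
  by rewrite in_itv/= d0 leey.
by rewrite in_itv/= lee_fin r0 leey.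
Qed.

Lemma torus_dist_le_diam (A : set (R * R)) (x y : R * R) : A `<=` torus ->
  A x -> A y -> torus_dist x y <= torus_diam A.
Proof.
move=> At Ax Ay; rewrite -lee_fin /torus_diam.
have lb : ((torus_dist x y)%:E <= diameter torus_dist A)%E.
  by apply: ereal_sup_ubound; exists x => //; exists y.
rewrite fineK// fin_real//; apply/andP; split.
  by apply: lt_le_trans lb; rewrite ltNyr.
apply: (@le_lt_trans _ _ (Num.sqrt (1 ^+ 2 + 1 ^+ 2))%:E); last by rewrite ltry.
apply: ge_ereal_sup => _ [u Au [v Av <-]]; rewrite lee_fin.
by apply: torus_dist_le; [exact: At|exact: At|exact: circle_dist_le1|exact: circle_dist_le1].
Qed.

Lemma translate_half_le (xi x y : R * R) (A : set (R * R)) (b1 b2 : bool) :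
  A `<=` torus -> A x -> A y ->
  half b1 (torus_add xi x).1 -> half b1 (torus_add xi y).1 ->
  half b2 (torus_add xi x).2 -> half b2 (torus_add xi y).2 ->
  euclid_dist (torus_add xi x) (torus_add xi y) <= torus_diam A.
Proof.
move=> At Ax Ay h1 h2 h3 h4; apply: le_trans (torus_dist_le_diam At Ax Ay).
have /torusP[x1 x2] := At _ Ax; have /torusP[y1 y2] := At _ Ay.
rewrite euclid_distE /torus_dist; apply: ler_wsqrtr; apply: lerD.
  rewrite -real_normK ?num_real//; apply: lerXn2r; rewrite ?nnegrE ?normr_ge0 ?circle_dist_ge0//.
  exact: (circle_dist_half x1 y1 h1 h2).
rewrite -real_normK ?num_real//; apply: lerXn2r; rewrite ?nnegrE ?normr_ge0 ?circle_dist_ge0//.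
exact: (circle_dist_half x2 y2 h3 h4).
Qed.

Lemma half_self (x : R) : half (x < 1 / 2) x.
Proof. by rewrite /half; case: ltP. Qed.

(** Piece [i] of the cover is the part of the translate of index [k + i / 4] in
the quarter of the square encoded by the two low bits of [i]. *)
Lemma projection_null (g : nat -> set (R * R)) (xi : nat -> R * R) (t p : R) (l : line R) :
  (forall n, g n `<=` torus) -> 0 < t -> 1 < p ->
  (fun n => torus_diam (g n)) @ \oo --> (0 : R) ->
  (\forall n \near \oo, 0 <= torus_diam (g n) /\ torus_diam (g n) `^ t <= n.+1%:R `^ (- p)) ->
  hausdorff_measure euclid_dist t
    (orth_proj l @` lim_sup_set (fun n => torus_translate (xi n) (g n))) = 0%E.
Proof.
move=> gt t0 p1 rho0 hrho; apply: hausdorff_measure_eq0 => delta e d0 e0.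
have q0 : 0 < p - 1 by rewrite subr_gt0.
have p0 : 0 < p by apply: lt_trans p1.
pose C : R := 4 `^ p.
have C0 : 0 < C by rewrite powR_gt0.
(* The tail of the cover from [k] on meets both requirements. *)
have [k [k0 hk1 hk2]] : exists k, [/\ (0 < k)%N,
   forall n, (k <= n)%N -> [/\ torus_diam (g n) <= delta, 0 <= torus_diam (g n) &
       torus_diam (g n) `^ t <= n.+1%:R `^ (- p)] &
   C * ((4 * k)%:R `^ (- (p - 1)) / (p - 1)) <= e].
  have [k1 _ h1] := hrho.
  have [k2 _ h2] : \forall n \near \oo, torus_diam (g n) < delta.
    exact: (@cvgr_lt _ _ _ _ _ _ rho0 _ d0).
  pose b := e * (p - 1) / C.
  have b0 : 0 < b by rewrite divr_gt0// mulr_gt0.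
  pose k3 := (Num.truncn (b `^ (- (p - 1)^-1))).+1.
  exists (maxn k3 (maxn k1 k2)); split.
  - by rewrite leq_max.
  - move=> n; rewrite !geq_max => /and3P[_ n1 n2].
    by have [? ?] := h1 _ n1; split => //; exact/ltW/h2.
  rewrite mulrA ler_pdivrMr// mulrC -ler_pdivlMr// -/b.
  set k := maxn _ _.
  have kb : b `^ (- (p - 1)^-1) <= (4 * k)%:R.
    apply: le_trans (ltW (truncnS_gt _)) _; rewrite ler_nat.
    by rewrite (leq_trans (leq_maxl _ (maxn k1 k2)))// leq_pmull.
  have b1 : 0 < b `^ (- (p - 1)^-1) by rewrite powR_gt0.
  have bE : b = (b `^ (- (p - 1)^-1)) `^ (- (p - 1)).
    rewrite -powRrM (_ : _ * _ = 1) ?powRr1 ?(ltW b0)//.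
    by field; rewrite gt_eqF.
  rewrite [leRHS]bE (powRN (4 * k)%:R) (powRN (b `^ _)).
  rewrite lef_pV2 ?posrE ?powR_gt0 ?(lt_le_trans b1 kb)//.
    by apply: ge0_ler_powR; rewrite ?nnegrE ?(ltW q0) ?(ltW b1).
pose piece i := torus_translate (xi (k + i %/ 4)%N) (g (k + i %/ 4)%N) `&`
  [set y | half (odd i) y.1 /\ half (odd (i %/ 2)) y.2].
have pieceP i x y : (orth_proj l @` piece i) x -> (orth_proj l @` piece i) y ->
    euclid_dist x y <= torus_diam (g (k + i %/ 4)%N).
  move=> [_ [[u gu <-] [u1 u2]] <-] [_ [[v gv <-] [v1 v2]] <-].
  apply: le_trans (orth_proj_lip _ _ _) _.
  exact: (translate_half_le (gt _) gu gv u1 v1 u2 v2).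
pose U i : set (R * R) := orth_proj l @` piece i.
exists U.
split.
- move=> _ [y hy <-]; have [n /= kn yn] := hy k I.
  pose b1 := y.1 < 1 / 2; pose b2 := y.2 < 1 / 2.
  pose i := (4 * (n - k) + (b1 + 2 * b2))%N.
  have b4 : (b1 + 2 * b2 < 4)%N by case: (b1); case: (b2).
  have i4 : (i %/ 4 = n - k)%N by rewrite /i mulnC divnMDl// divn_small ?addn0.
  have i1 : odd i = b1.
    by rewrite /i oddD oddM/= oddD oddM/= addbF oddb.
  have i2 : odd (i %/ 2) = b2.
    have -> : i = ((2 * (n - k) + b2) * 2 + b1)%N by rewrite /i; ring.
    have b12 : (b1 < 2)%N by case: (b1).
    by rewrite divnMDl// (divn_small b12) addn0 oddD oddM/= oddb.
  exists i => //; exists y => //; rewrite /piece i4 i1 i2 subnKC//; split => //.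
  by split; exact: half_self.
- move=> i; have [rd _ _] := hk1 _ (leq_addr (i %/ 4) k).
  apply: ge_ereal_sup => _ [x hx [y hy <-]]; rewrite lee_fin.
  by apply: le_trans rd; exact: pieceP.
have bound i : (hausdorff_gauge euclid_dist t (orth_proj l @` piece i) <=
    C%:E * ((4 * k + i).+1%:R `^ (- p))%:E)%E.
  have [_ r0 rt] := hk1 _ (leq_addr (i %/ 4) k).
  apply: le_trans (gauge_le (ltW t0) r0 _ (@pieceP i)) _.
    by move=> x y; rewrite /euclid_dist sqrtr_ge0.
  rewrite -EFinM lee_fin (le_trans rt)//.
  have -> : C = (4^-1) `^ (- p) by rewrite /C -[4^-1]powR_inv1// -powRrM mulN1r opprK.
  have e1 : 0 < 4^-1 * (4 * k + i).+1%:R :> R by rewrite mulr_gt0// invr_gt0.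
  rewrite -powRM// !powRN lef_pV2 ?posrE ?powR_gt0//.
  apply: ge0_ler_powR; rewrite ?nnegrE ?(ltW p0) ?(ltW e1)//.
  rewrite mulrC ler_pdivrMr// -natrM ler_nat.
  have := ltn_ceil i (isT : 0 < 4)%N; move: (i %/ 4)%N => j; clear; lia.
apply: (@le_trans _ _ (\sum_(0 <= i <oo) (C%:E * ((4 * k + i).+1%:R `^ (- p))%:E))%E).
  by apply: lee_nneseries => [*|i _]; [exact: hausdorff_gauge_ge0|exact: bound].
rewrite nneseriesZl; last by move=> *; rewrite lee_fin powR_ge0.
apply: le_trans (_ : C%:E * ((4 * k)%:R `^ (- (p - 1)) / (p - 1))%:E <= _)%E.
  by rewrite lee_pmul2l// tail_series// muln_gt0.
by rewrite -EFinM lee_fin.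
Qed.

End Cover.

(** * Positive measure of the projections *)

Section Lower.
Context {R : realType}.

Lemma frac_addz (y : R) (k : int) : frac (y + k%:~R) = frac y.
Proof.
have fE : Num.floor (y + k%:~R) = Num.floor y + k.
  apply: Num.Theory.floor_def; have := floor_itv y; rewrite !intrD; lra.
by rewrite /frac fE intrD; ring.
Qed.

Lemma torus_translate_near (xi x y : R * R) (r : R) (A : set (R * R)) :
  torus xi -> torus x -> torus y -> 0 < r -> torus_ball x r `<=` A ->
  sup_near (r / 2) y (torus_add xi x) -> torus_translate xi A y.
Proof.
move=> /torusP[xi1 xi2] tx /[dup] ty /torusP[y1 y2] r0 xA [n1 n2].
have /torusP[x1 x2] := tx.
have fracK (u v : R) : 0 <= v < 1 -> frac (u + frac (v - u)) = v.
  move=> hv; rewrite {2}/frac.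
  have -> : u + (v - u - (Num.floor (v - u))%:~R) = v + (- Num.floor (v - u))%:~R.
    by rewrite rmorphN/=; ring.
  by rewrite frac_addz frac_id.
have close (u v z : R) : 0 <= v < 1 -> `|z - frac (u + v)| <= r / 2 ->
    circle_dist v (frac (z - u)) <= r / 2.
  move=> hv; apply: le_trans.
  pose k := (Num.floor (u + v) - Num.floor (z - u))%R.
  have fz := frac_itv (z - u).
  have vz : `|v - frac (z - u)| < 1 by rewrite ltr_norml; apply/andP; split; lra.
  have -> : z - frac (u + v) =
      - (v - frac (z - u) + (- Num.floor (z - u) - Num.floor (u + v))%:~R).
    by rewrite /frac rmorphB rmorphN/=; ring.
  by rewrite normrN; exact: circle_dist_shift.
exists (frac (y.1 - xi.1), frac (y.2 - xi.2)); last first.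
  by rewrite /torus_add/= !fracK//; case: (y).
have tz : torus (frac (y.1 - xi.1), frac (y.2 - xi.2)).
  by apply/torusP; split; exact: frac_itv.
apply: xA; split => //.
apply: le_lt_trans (torus_dist_le tx tz (close _ _ _ x1 n1) (close _ _ _ x2 n2)) _.
have -> : (r / 2) ^+ 2 + (r / 2) ^+ 2 = r ^+ 2 / 2 by field.
rewrite -[ltRHS](ger0_norm (ltW r0)) -sqrtr_sqr ltr_sqrt ?exprn_gt0//.
have : 0 < r ^+ 2 by rewrite exprn_gt0.
lra.
Qed.

(** Divide the linear form that defines the projection by the larger coordinate
of the direction; this changes it by a factor at most [sqrt 2]. *)
Lemma line_slanted (l : line R) : exists al be, slanted al be /\
  forall x y, `|lin al be x - lin al be y|
     <= 2 * euclid_dist (orth_proj l x) (orth_proj l y).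
Proof.
have D0 := dot_dir_gt0 l.
set v := line_dir l in D0 *.
suff [al [be [k [sl k0 kD lE]]]] : exists al be k, [/\ slanted al be, 0 < k,
    dot v v <= 4 * k ^+ 2 & forall x y, `|lin al be x - lin al be y| = `|dot (x - y) v| / k].
  exists al, be; split => // x y; rewrite lE orth_projB -/v.
  have -> : `|dot (x - y) v| / k = Num.sqrt ((dot (x - y) v / k) ^+ 2).
    by rewrite sqrtr_sqr normrM normfV (gtr0_norm k0).
  have -> : 2 = Num.sqrt (2 ^+ 2) :> R by rewrite sqrtr_sqr ger0_norm.
  rewrite -sqrtrM ?sqr_ge0//; apply: ler_wsqrtr.
  rewrite exprMn exprVn mulrCA ler_wpM2l ?sqr_ge0//.
  rewrite -[leLHS]mul1r ler_pdivrMr ?exprn_gt0// mulrAC ler_pdivlMr// mul1r.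
  by rewrite (_ : 2 ^+ 2 = 4)//; ring.
have vE : dot v v = v.1 ^+ 2 + v.2 ^+ 2 by rewrite /dot !expr2.
have aux (a b : R) : `|b| <= `|a| -> 0 < a ^+ 2 + b ^+ 2 ->
    [/\ 0 < `|a|, a != 0, `|b / a| <= 1 & a ^+ 2 + b ^+ 2 <= 4 * `|a| ^+ 2].
  move=> ba ab0; have b2 : b ^+ 2 <= a ^+ 2.
    by rewrite -(real_normK (num_real b)) -(real_normK (num_real a)) lerXn2r.
  have a0 : a != 0.
    by apply/eqP => a0; move: ab0 b2; rewrite a0 expr0n/=; lra.
  have a0' : 0 < `|a| by rewrite normr_gt0.
  split => //; first by rewrite normrM normfV ler_pdivrMr// mul1r.
  rewrite real_normK ?num_real//; have := sqr_ge0 a; lra.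
rewrite vE in D0; have [h|h] := leP `|v.2| `|v.1|.
  have [k0 v0 b1 hk] := aux _ _ h D0.
  exists 1, (v.2 / v.1), `|v.1|; split => //.
  - by rewrite /slanted normr1; split => //; left.
  - move=> x y; rewrite -normfV -normrM; congr `|_|.
    by rewrite /lin /dot /=; field.
rewrite addrC in D0; have [k0 v0 b1 hk] := aux _ _ (ltW h) D0.
exists (v.1 / v.2), 1, `|v.2|; split => //.
- by rewrite /slanted normr1; split => //; right.
- by rewrite vE addrC.
- move=> x y; rewrite -normfV -normrM; congr `|_|.
  by rewrite /lin /dot /=; field.
Qed.

Lemma eseries_half (e : R) :
  (\sum_(0 <= i <oo) (e / 2 ^+ i.+1)%:E = e%:E)%E.
Proof.
have := @cvg_geometric_eseries_half R e 0; rewrite expr0 divr1 => h.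
rewrite (@eq_eseriesr _ _ (fun k => (e / (2 ^ (k + 1))%:R)%:E)).
  exact/cvg_lim.
by move=> i _; rewrite natrX addn1.
Qed.

Section Projection.
Variables (g : nat -> set (R * R)) (xi x : nat -> R * R) (delta : nat -> R).
Hypothesis xi_torus : forall n, torus (xi n).
Hypothesis x_torus : forall n, torus (x n).
Hypothesis delta_gt0 : forall n, 0 < delta n.
Hypothesis ballg : forall n, torus_ball (x n) (delta n) `<=` g n.

(** A cover with small total gauge is turned into strips by [line_slanted]. Widths
must be positive, so a summable amount is added to the powers of the
diameters. *)
Lemma projection_not_null (t0 s : R) (L a M n1 : nat) (l : line R) :
  admissible t0 L a -> (0 < M)%N ->
  (forall m h0, (n1 <= m)%N -> exists2 h, (h0 <= h)%N &
     good_scale (fun n => torus_add (xi n) (x n)) delta L a M m h) ->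
  0 <= s <= t0 ->
  hausdorff_measure euclid_dist s
    (orth_proj l @` lim_sup_set (fun n => torus_translate (xi n) (g n))) != 0%E.
Proof.
move=> adm M0 good /andP[s0 st]; apply/eqP => mu0.
have t01 := admissible_lt1 adm; have [t00 _ _ _] := adm.
set E := (X in hausdorff_measure _ _ X) in mu0.
have e0 : 0 < 400^-1 :> R by rewrite invr_gt0 ltr0n.
have : (hausdorff_content euclid_dist s 1 E < 400^-1%:E)%E.
  apply: (@le_lt_trans _ _ 0%E); last by rewrite lte_fin.
  by rewrite -mu0; apply: ereal_sup_ubound; exists 1 => //=.
move=> /ereal_inf_lt[_ [U [EU U1] <-] Ue].
have [al [be [sl lE]]] := line_slanted l.
(* [d i] is the diameter of [U i], read as 0 when [U i] is empty. *)
have /choice[d hd] i : exists d : R, [/\ 0 <= d,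
    forall p q, U i p -> U i q -> euclid_dist p q <= d
  & ((d `^ t0)%:E <= hausdorff_gauge euclid_dist s (U i))%E].
  have [U0|/set0P[p Up]] := eqVneq (U i) set0.
    exists 0; split => //; first by rewrite U0.
    by rewrite powR0 ?gt_eqF// hausdorff_gauge_ge0.
  have pq p' q' : U i p' -> U i q' ->
      ((euclid_dist p' q')%:E <= diameter euclid_dist (U i))%E.
    by move=> ? ?; apply: ereal_sup_ubound; exists p' => //; exists q'.
  have d0 : (0 <= diameter euclid_dist (U i))%E.
    by apply: le_trans (pq _ _ Up Up); rewrite lee_fin /euclid_dist sqrtr_ge0.
  have dfin : diameter euclid_dist (U i) \is a fin_num.
    by rewrite ge0_fin_numE// (le_lt_trans (U1 i))// ltry.
  have f0 : 0 <= fine (diameter euclid_dist (U i)) by rewrite -lee_fin fineK.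
  have f1 : fine (diameter euclid_dist (U i)) <= 1 by rewrite -lee_fin fineK.
  exists (fine (diameter euclid_dist (U i))); split => //.
    by move=> p' q' ? ?; rewrite -lee_fin fineK// pq.
  rewrite /hausdorff_gauge; case: asboolP => [U0|_].
    by rewrite U0 in Up.
  rewrite -{2}(fineK dfin) poweR_EFin lee_fin.
  move: f0; rewrite le_eqVlt => /orP[/eqP <-|f0].
    by rewrite powR0 ?gt_eqF// powR_ge0.
  by apply: ger_powR => //; rewrite f0.
pose eps i : R := 400^-1 / 2 ^+ i.+1.
have eps0 i : 0 < eps i by rewrite divr_gt0// exprn_gt0.
pose r i := (d i `^ t0 + eps i) `^ t0^-1.
have s_gt0 i : 0 < d i `^ t0 + eps i by rewrite ltr_wpDl// powR_ge0.
have r0 i : 0 < r i by rewrite powR_gt0.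
have rE i : r i `^ t0 = d i `^ t0 + eps i.
  by rewrite /r -powRrM mulVf ?gt_eqF// powRr1// ltW.
have dr i : d i <= r i.
  have [d0 _ _] := hd i.
  have {1}-> : d i = (d i `^ t0) `^ t0^-1.
    by rewrite -powRrM divff ?gt_eqF// powRr1.
  apply: ge0_ler_powR;
    rewrite ?nnegrE ?invr_ge0 ?(ltW t00) ?powR_ge0 ?(ltW (s_gt0 _))//.
  by rewrite lerDl ltW.
pose t i := 2 * r i.
have tgt0 i : 0 < t i by rewrite mulr_gt0.
(* The level is arbitrary when [U i] misses the line. *)
have /choice[ga hga] i : exists ga : R, forall y : R * R, U i (orth_proj l y) ->
    `|lin al be y - ga| <= t i.
  have [[z Uz]|nz] := pselect (exists z, U i (orth_proj l z)); last first.
    by exists 0 => y Uy; exfalso; apply: nz; exists y.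
  exists (lin al be z) => y Uy; apply: le_trans (lE y z) _.
  have [_ hU _] := hd i.
  by rewrite ler_pM2l// (le_trans (hU _ _ Uy Uz)).
(* The cover and the added amounts contribute at most [400^-1] each, and the
   factor [2] in [t] at most doubles the powers. *)
have tsum : (\sum_(0 <= i <oo) (t i `^ t0)%:E < 100^-1%:E)%E.
  apply: (@le_lt_trans _ _ (\sum_(0 <= i <oo) (2%:E * ((d i `^ t0)%:E + (eps i)%:E)))%E).
    apply: lee_nneseries => [*|i _]; first by rewrite lee_fin powR_ge0.
    rewrite -EFinD -EFinM lee_fin /t powRM ?(ltW (r0 _))// rE.
    rewrite ler_wpM2r ?(ltW (s_gt0 _))//.
    by apply: ler1_powR => //; [rewrite ler1n|exact: ltW].
  rewrite nneseriesZl; last by move=> i _; rewrite -EFinD lee_fin ltW.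
  rewrite nneseriesD; [|by move=> *; rewrite lee_fin powR_ge0|by move=> *; rewrite lee_fin ltW].
  rewrite eseries_half.
  apply: (@lt_le_trans _ _ (2%:E * (400^-1%:E + 400^-1%:E))%E); last first.
    by rewrite -EFinD -EFinM lee_fin; lra.
  rewrite lte_pmul2l// lteD2rE//; apply: le_lt_trans Ue.
  apply: lee_nneseries => [*|i _]; first by rewrite lee_fin powR_ge0.
  by have [_ _] := hd i.
have [y [ycent ystrip yballs]] := descent adm M0 good ga (fun=> sl) tgt0 tsum.
have ty : torus y.
  case: ycent => /=; rewrite !ler_norml => /andP[? ?] /andP[? ?].
  by apply/torusP; split; lra.
have : E (orth_proj l y).
  exists y => // m _; have [n mn ny] := yballs m; exists n => //.
  exact: (torus_translate_near (xi_torus n) (x_torus n) ty (delta_gt0 n) (@ballg n)).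
move=> /EU[i _ Uy]; have := ystrip i; rewrite ltNge => /negP; apply.
exact: hga.
Qed.

End Projection.
End Lower.

(** * The dimension of the projections *)

Lemma s0_ge0 (R : realType) (g : nat -> set (R * R)) :
  (\forall n \near \oo, ln (torus_diam (g n)) < 0) -> (0 <= s0 g)%E.
Proof.
move=> lneg; rewrite leNgt; apply/negP => /limn_esup_lt slt.
have : \forall n \near \oo, False.
  near=> n.
  have l0 : ln (torus_diam (g n)) < 0 by near: n.
  have : ((ln n.+1%:R / - ln (torus_diam (g n)))%:E < 0)%E by near: n.
  by rewrite lte_fin ltNge divr_ge0// ?ln_ge0 ?ler1n// oppr_ge0 ltW.
by move=> [n _ /(_ n (leqnn n))].
Unshelve. all: by end_near. Qed.

Lemma dim_projection_le (R : realType) (g : nat -> set (R * R)) (xi : nat -> R * R)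
    (sigma : R) (l : line R) :
  ball_like g -> s0 g = sigma%:E -> 0 <= sigma ->
  (hausdorff_dim euclid_dist
    (orth_proj l @` lim_sup_set (fun n => torus_translate (xi n) (g n))) <= s0 g)%E.
Proof.
move=> [gt _ rho0 [x [delta [_ ratio]]]] sE sigma0.
rewrite sE; apply/lee_addgt0Pr => e e0.
have e2 : 1 < (2 : R) by rewrite ltr1n.
have near1 := ln_ratio_near rho0 ratio e2.
pose s' := sigma + e / 2; pose t := sigma + e.
have s'0 : 0 < s' by rewrite /s' ltr_wpDl// divr_gt0.
have t0 : 0 < t by rewrite ltr_wpDl.
have s't : s' < t by rewrite /s' /t ltrD2l; lra.
have slt : (s0 g < s'%:E)%E by rewrite sE lte_fin /s' ltrDl divr_gt0.
have near2 := limn_esup_lt slt.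
rewrite -EFinD; apply: ereal_inf_lbound; exists t => //; split; first exact: ltW.
apply: (@projection_null _ g xi t (t / s')) => //.
  by rewrite ltr_pdivlMr// mul1r.
near=> n.
have [/andP[r0 r1] lr _] : [/\ 0 < torus_diam (g n) < 1, ln (torus_diam (g n)) < 0
   & 2 * ln (torus_diam (g n)) <= ln (delta n)] by near: n.
split; first exact: ltW.
have : ((ln n.+1%:R / - ln (torus_diam (g n)))%:E < s'%:E)%E by near: n.
rewrite lte_fin ltr_pdivrMr ?oppr_gt0// => h.
rewrite /powR !gt_eqF// ler_expR mulNr lerNr -mulrN.
rewrite mulrAC ler_pdivrMr// -mulrA ler_pM2l// mulrC ltW//.
Unshelve. all: by end_near. Qed.

Theorem theorem5p1 (R : realType) (d : measure_display) (T : measurableType d)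
    (P : probability T R) (g : nat -> set (R * R))
    (xi : nat -> {RV P >-> (R * R)%type}) :
  ball_like g ->
  independent_RVs xi ->
  (forall n, uniform_torus (xi n)) ->
  (s0 g < 1)%E ->
  {ae P, forall w, forall l : line R,
    hausdorff_dim euclid_dist (orth_proj l @` random_covering_set xi g w)
      = s0 g}.
Proof.
move=> bg indep unif s01.
have [gt rho_dec rho0 [x [delta [hball ratio]]]] := bg.
have s00 : (0 <= s0 g)%E.
  apply: s0_ge0; have := ln_ratio_near rho0 ratio (ltr1n _ 2 : 1 < 2 :> R).
  by apply: filterS => n [].
have [sigma sE] : exists sigma, s0 g = sigma%:E.
  exists (fine (s0 g)); rewrite fineK// ge0_fin_numE//.
  by apply: lt_trans s01 _; rewrite ltry.
have sigma0 : 0 <= sigma by rewrite -lee_fin -sE.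
have sigma1 : sigma < 1 by rewrite -lte_fin -sE.
have delta0 n : 0 < delta n by have [] := hball n.
have x_torus n : torus (x n) by have [] := hball n.
have ballg n : torus_ball (x n) (delta n) `<=` g n by have [] := hball n.
have xi_torus n w : torus (xi n w) by have [] := unif n.
pose t (k : nat) := sigma * (1 - k.+2%:R^-1).
have lower k : {ae P, forall w, 0 < sigma -> forall l : line R, forall s, 0 <= s <= t k ->
    hausdorff_measure euclid_dist s (orth_proj l @` random_covering_set xi g w) != 0%E}.
  have [sigma_gt0|] := ltP 0 sigma; last first.
    by move=> _; apply: aeW.
  have k2 : 0 < k.+2%:R^-1 :> R by rewrite invr_gt0.
  have k1 : k.+2%:R^-1 < 1 :> R by rewrite invf_lt1// ltr1n.
  pose s := (t k + sigma) / 2.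
  have tk : 0 < t k by rewrite mulr_gt0// subr_gt0.
  have ts : t k < sigma by rewrite /t gtr_pMr// gtrBl.
  have ht : 0 < t k < s by rewrite tk/= /s; lra.
  have hs : s < 1 by rewrite /s; lra.
  have hls : (s%:E < limn_esup (fun n => (ln n.+1%:R / - ln (torus_diam (g n)))%:E))%E.
    by rewrite -/(s0 g) sE lte_fin /s; lra.
  have [L [a [n1 [adm hr]]]] := scales_radius rho_dec rho0 ratio delta0 ht hs hls.
  have := ae_good_scale indep unif x_torus hr.
  apply: filterS => w good _ l s' hs'.
  have M0 : (0 < 4 * L + 5)%N by rewrite addn_gt0 orbT.
  exact: (projection_not_null (fun n => xi_torus n w) x_torus delta0 ballg l adm M0 good hs').
have := ae_foralln lower; apply: filterS => w hw l.
apply/eqP; rewrite eq_le; apply/andP; split.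
  exact: (dim_projection_le (fun n => xi n w) l bg sE sigma0).
apply: le_ereal_inf_tmp => _ [s [s_ge0 mu0] <-].
rewrite leNgt; apply/negP; rewrite sE lte_fin => ss.
have sigma_gt0 : 0 < sigma by apply: le_lt_trans ss.
pose k := Num.truncn (sigma / (sigma - s)).
have hk : s <= t k.
  have d0 : 0 < sigma - s by rewrite subr_gt0.
  have : sigma / (sigma - s) <= k.+2%:R.
    apply: le_trans (ltW (truncnS_gt _)) _; by rewrite ler_nat.
  rewrite ler_pdivrMr// -ler_pdivrMl// /t mulrBr mulr1 [sigma * _]mulrC.
  move: (_^-1 * sigma) => v; lra.
have := hw k sigma_gt0 l s; rewrite s_ge0 hk => /(_ isT) /eqP; apply.
exact: mu0.
Qed.
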